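(* Let $F$ be a differentially closed field of characteristic zero with derivations $d_x,d_y$, and let $P\in F[d_x,d_y]$ be a third-order operator with non-separable symbol $\mathrm{symb}(P)$. (i) Suppose that $\mathrm{symb}(P)$ has two different linear divisors (one of which has multiplicity 2), normalized so that $$P=d_y^2d_x+p_0d_x^2+p_1d_y^2+p_2d_xd_y+p_3d_y+p_4d_x+p_5,\qquad p_0,\dots,p_5\in F.$$ If $p_0\neq 0$, then $\langle P\rangle$ has at most two maximal non-holonomic overideals. Moreover, if there exist two different maximal non-holonomic overideals $I_1,I_2\supset\langle P\rangle$, then $\langle P\rangle=I_1\cap I_2$. (ii) Suppose that $\mathrm{symb}(P)$ has a single linear divisor (of multiplicity 3), normalized so that $$P=d_y^3+p_0d_x^2+p_1d_y^2+p_2d_xd_y+p_3d_y+p_4d_x+p_5,\qquad p_0,\dots,p_5\in F.$$ If at least one of $p_0\neq 0$, $p_2\neq 0$, $p_4\neq 0$ holds, then $\langle P\rangle$ has at most two maximal non-holonomic overideals. Moreover, if in this case there exist two different maximal non-holonomic overideals $I_1,I_2\supset\langle P\rangle$, then $\langle P\rangle=I_1\cap I_2$. Otherwise, i.e. if $p_0=p_2=p_4=0$, the ideal $\langle P\rangle=\langle d_y^3+p_1d_y^2+p_3d_y+p_5\rangle$ has an infinite number of maximal non-holonomic overideals.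
   Context: The derivations $d_x,d_y$ of $F$ commute, and $F[d_x,d_y]$ is the (non-commutative) ring of linear partial differential operators $\sum_{i,j}p_{i,j}d_x^id_y^j$ with coefficients $p_{i,j}\in F$, where $d_xd_y=d_yd_x$, $d_x f=f d_x+d_x(f)$ and $d_y f=f d_y+d_y(f)$ for $f\in F$. All ideals are left ideals, and $\langle P\rangle$ denotes the left ideal generated by $P$. For an operator $P=\sum_{i+j\le n}p_{i,j}d_x^id_y^j$ of order $n$, its symbol is the homogeneous polynomial $\mathrm{symb}(P)=\sum_{i+j=n}p_{i,j}v^iw^j\in F[v,w]$ of degree $n$. It is separable if it has no multiple linear factors. For a left ideal $I$, the Hilbert-Kolchin polynomial is the polynomial in $z$ which for all large integers $z$ equals the $F$-dimension of the image in $F[d_x,d_y]/I$ of the space of operators of order at most $z$. The ideal $I$ is called non-holonomic if its Hilbert-Kolchin polynomial has degree exactly $1$. An overideal of an ideal $J$ is a left ideal containing $J$ (possibly equal to $J$). A maximal non-holonomic overideal of $J$ is a non-holonomic overideal of $J$ which is maximal with respect to inclusion among all non-holonomic overideals of $J$. *)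

(* Defs.v *)
From HB Require Import structures.
From mathcomp Require Import all_boot all_order all_algebra.
From mathcomp Require Import boolp classical_sets functions cardinality.
From mathcomp Require Import mpoly ssrcomplements bigenough.

Set Implicit Arguments.
Unset Strict Implicit.
Unset Printing Implicit Defensive.

Import GRing.Theory BigEnough.
Local Open Scope ring_scope.

(** * Fields with two commuting derivations *)

HB.mixin Record Field_isPdiff F of GRing.Field F := {
  derx : F -> F;
  dery : F -> F;
  derxD : {morph derx : a b / a + b};
  deryD : {morph dery : a b / a + b};
  derxM : forall a b : F, derx (a * b) = derx a * b + a * derx b;
  deryM : forall a b : F, dery (a * b) = dery a * b + a * dery b;
  derxyC : forall a : F, derx (dery a) = dery (derx a);
}.

#[short(type="pdiffFieldType")]
HB.structure Definition PdiffField := {F of GRing.Field F & Field_isPdiff F}.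

(** * Differentially closed fields *)

(* Expressions for the differential polynomials with coefficients in F in the
   differential indeterminates X_0, X_1, ...; [DVar k i j] stands for
   d_x^i d_y^j X_k. *)
Inductive dpoly (F : Type) : Type :=
  | DConst of F
  | DVar of nat & nat & nat
  | DAdd of dpoly F & dpoly F
  | DMul of dpoly F & dpoly F.

Fixpoint deval (F : Type) (K : pdiffFieldType) (iota : F -> K) (e : nat -> K)
    (f : dpoly F) : K :=
  match f with
  | DConst c => iota c
  | DVar k i j => iter i derx (iter j dery (e k))
  | DAdd g h => deval iota e g + deval iota e h
  | DMul g h => deval iota e g * deval iota e h
  end.

Definition dpoly_solution (F : Type) (K : pdiffFieldType) (iota : F -> K)
    (m n : nat) (f : 'I_m -> dpoly F) (g : 'I_n -> dpoly F) (e : nat -> K) :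
    Prop :=
  (forall i, deval iota e (f i) = 0) /\ (forall j, deval iota e (g j) != 0).

(* Every finite system of differential polynomial equations and inequations
   over F that is solvable in some differential extension field is already
   solvable in F. *)
Definition differentially_closed (F : pdiffFieldType) : Prop :=
  forall (K : pdiffFieldType) (iota : {rmorphism F -> K}),
    (forall a, iota (derx a) = derx (iota a)) ->
    (forall a, iota (dery a) = dery (iota a)) ->
  forall (m n : nat) (f : 'I_m -> dpoly F) (g : 'I_n -> dpoly F),
    (exists e : nat -> K, dpoly_solution iota f g e) ->
    exists e : nat -> F, dpoly_solution (fun a : F => a) f g e.

(** * The ring of linear partial differential operators *)

Section DerTheory.
Variable F : pdiffFieldType.
Implicit Types (a b : F).

Lemma derx_zmod : zmod_morphism (@derx F).
Proof. by move=> a b; apply/(addIr (derx b)); rewrite subrK -derxD subrK. Qed.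

HB.instance Definition _ := GRing.isZmodMorphism.Build F F (@derx F) derx_zmod.

Lemma dery_zmod : zmod_morphism (@dery F).
Proof. by move=> a b; apply/(addIr (dery b)); rewrite subrK -deryD subrK. Qed.

HB.instance Definition _ := GRing.isZmodMorphism.Build F F (@dery F) dery_zmod.

Lemma derx1 : derx (1 : F) = 0.
Proof.
by have /eqP := derxM (1 : F) 1; rewrite !mulr1 mul1r -subr_eq0 opprD addNKr
  oppr_eq0 => /eqP.
Qed.

Lemma dery1 : dery (1 : F) = 0.
Proof.
by have /eqP := deryM (1 : F) 1; rewrite !mulr1 mul1r -subr_eq0 opprD addNKr
  oppr_eq0 => /eqP.
Qed.

End DerTheory.

(* The operator \sum p_{i,j} d_x^i d_y^j is represented by the polynomial
   \sum p_{i,j} 'X_0^i 'X_1^j; only the multiplication differs from the one of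
   {mpoly F[2]}. *)
Definition diffop (F : pdiffFieldType) : Type := {mpoly F[2]}.

Section DiffopMul.
Variable F : pdiffFieldType.
Local Notation poly2 := {mpoly F[2]}.
Implicit Types (P Q R : poly2) (c : F) (m : 'X_{1..2}).

Definition ix : 'I_2 := @Ordinal 2 0 isT.
Definition iy : 'I_2 := @Ordinal 2 1 isT.

(* Left multiplication by d_x, as forced by d_x f = f d_x + d_x(f). *)
Definition lmulx Q : poly2 := 'X_ix * Q + map_mpoly (@derx F) Q.
Definition lmuly Q : poly2 := 'X_iy * Q + map_mpoly (@dery F) Q.

Definition lmulm m Q : poly2 := iter (m ix) lmulx (iter (m iy) lmuly Q).

Definition diffop_mul P Q : poly2 := \sum_(m <- msupp P) P@_m *: lmulm m Q.

Lemma map_der_X (d : {additive F -> F}) i Q :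
  map_mpoly d ('X_i * Q) = 'X_i * map_mpoly d Q.
Proof.
have dZ c m : map_mpoly d (c *: 'X_[m]) = d c *: 'X_[m] :> poly2.
  apply/mpolyP=> m'; rewrite mcoeff_map_mpoly !mcoeffZ mcoeffX.
  by case: eqP; rewrite ?mulr1 ?mulr0 ?raddf0.
rewrite [Q]mpolyE mulr_sumr !raddf_sum mulr_sumr; apply: eq_bigr => m _.
by rewrite -scalerAr -mpolyXD /= !dZ -scalerAr -mpolyXD.
Qed.

Lemma map_derZ (d : {additive F -> F}) :
  (forall a b, d (a * b) = d a * b + a * d b) ->
  forall c Q, map_mpoly d (c *: Q) = d c *: Q + c *: map_mpoly d Q.
Proof.
move=> dM c Q; apply/mpolyP=> m.
by rewrite mcoeffD !mcoeffZ !mcoeff_map_mpoly mcoeffZ dM.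
Qed.

Lemma lmulx_zmod : zmod_morphism lmulx.
Proof. by move=> P Q; rewrite /lmulx mulrBr raddfB addrACA -opprD. Qed.

HB.instance Definition _ :=
  GRing.isZmodMorphism.Build poly2 poly2 lmulx lmulx_zmod.

Lemma lmuly_zmod : zmod_morphism lmuly.
Proof. by move=> P Q; rewrite /lmuly mulrBr raddfB addrACA -opprD. Qed.

HB.instance Definition _ :=
  GRing.isZmodMorphism.Build poly2 poly2 lmuly lmuly_zmod.

Lemma lmulxZ c Q : lmulx (c *: Q) = c *: lmulx Q + derx c *: Q.
Proof.
by rewrite /lmulx (map_derZ (@derxM F)) scalerDr scalerAr -addrA [_ + derx _ *: _]addrC.
Qed.

Lemma lmulyZ c Q : lmuly (c *: Q) = c *: lmuly Q + dery c *: Q.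
Proof.
by rewrite /lmuly (map_derZ (@deryM F)) scalerDr scalerAr -addrA [_ + dery _ *: _]addrC.
Qed.

Lemma lmulxyC Q : lmulx (lmuly Q) = lmuly (lmulx Q).
Proof.
rewrite /lmulx /lmuly !raddfD /= !map_der_X !mulrDr !addrA; congr (_ + _).
  by rewrite mulrCA -!addrA; congr (_ + _); rewrite addrC.
by apply/mpolyP=> m; rewrite !mcoeff_map_mpoly /= derxyC.
Qed.

Lemma lmulx_iter_lmuly n Q : lmulx (iter n lmuly Q) = iter n lmuly (lmulx Q).
Proof. by elim: n => //= n <-; rewrite lmulxyC. Qed.

Lemma lmuly_iter_lmulx n Q : lmuly (iter n lmulx Q) = iter n lmulx (lmuly Q).
Proof. by elim: n => //= n <-; rewrite lmulxyC. Qed.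

Lemma lmulm_zmod m : zmod_morphism (lmulm m).
Proof.
move=> P Q; rewrite /lmulm.
have -> : iter (m iy) lmuly (P - Q) = iter (m iy) lmuly P - iter (m iy) lmuly Q.
  by elim: (m iy) => //= n ->; rewrite raddfB.
by elim: (m ix) => //= n ->; rewrite raddfB.
Qed.

HB.instance Definition _ m :=
  GRing.isZmodMorphism.Build poly2 poly2 (lmulm m) (lmulm_zmod m).

Lemma lmulm0 Q : lmulm 0%MM Q = Q.
Proof. by rewrite /lmulm !mnm0E. Qed.

Lemma lmulmUx m Q : lmulm (U_(ix) + m)%MM Q = lmulx (lmulm m Q).
Proof. by rewrite /lmulm !mnmDE !mnm1E. Qed.

Lemma lmulmUy m Q : lmulm (U_(iy) + m)%MM Q = lmuly (lmulm m Q).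
Proof. by rewrite /lmulm !mnmDE !mnm1E /= lmuly_iter_lmulx. Qed.

Lemma lmulx_X m : lmulx 'X_[m] = 'X_[U_(ix) + m].
Proof.
rewrite /lmulx mpolyXD; apply/mpolyP=> m'.
rewrite mcoeffD mcoeff_map_mpoly mcoeffX /=.
by case: eqP => _; rewrite ?raddf0 ?derx1 addr0.
Qed.

Lemma lmuly_X m : lmuly 'X_[m] = 'X_[U_(iy) + m].
Proof.
rewrite /lmuly mpolyXD; apply/mpolyP=> m'.
rewrite mcoeffD mcoeff_map_mpoly mcoeffX /=.
by case: eqP => _; rewrite ?raddf0 ?dery1 addr0.
Qed.

Lemma mnm2E m : m = (U_(ix) *+ m ix + U_(iy) *+ m iy)%MM.
Proof.
by apply/mnmP=> -[[|[|//]] lt]; rewrite mnmDE !mulmnE !mnm1E /= mul0n mul1n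
  ?addn0 ?add0n; congr (m _); apply/val_inj.
Qed.

Lemma lmulm1 m : lmulm m 1 = 'X_[m].
Proof.
rewrite [in RHS](mnm2E m) /lmulm -mpolyX0.
have -> n : iter n lmuly 'X_[0%MM] = 'X_[U_(iy) *+ n].
  by elim: n => [|n /= ->]; rewrite ?mulm0n // lmuly_X mulmS.
elim: (m ix) => [|n /= ->]; first by rewrite mulm0n add0m.
by rewrite lmulx_X mulmS addmA.
Qed.

Lemma diffop_mulwE k P Q : (msize P <= k)%N ->
  diffop_mul P Q = \sum_(m : 'X_{1..2 < k}) P@_m *: lmulm m Q.
Proof.
move=> le_Pk; set I : subFinType _ := 'X_{1..2 < k}.
rewrite /diffop_mul (big_mksub I) ?msupp_uniq //=; first last.
  by move=> x /msize_mdeg_lt /leq_trans; apply.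
by rewrite big_rmcond //= => j /memN_msupp_eq0 ->; rewrite scale0r.
Qed.

Lemma diffop_mulDl : left_distributive diffop_mul +%R.
Proof.
move=> P Q R; pose_big_enough i.
  rewrite !(@diffop_mulwE i) // -big_split; apply: eq_bigr => m _.
  by rewrite mcoeffD scalerDl.
by close.
Qed.

Lemma diffop_mulDr : right_distributive diffop_mul +%R.
Proof.
move=> P Q R; rewrite /diffop_mul -big_split; apply: eq_bigr => m _.
by rewrite raddfD scalerDr.
Qed.

Lemma diffop_mulZl c P Q : diffop_mul (c *: P) Q = c *: diffop_mul P Q.
Proof.
pose_big_enough i.
  rewrite !(@diffop_mulwE i) // scaler_sumr; apply: eq_bigr => m _.
  by rewrite mcoeffZ scalerA.
by close.
Qed.

Lemma diffop_mulXl m Q : diffop_mul 'X_[m] Q = lmulm m Q.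
Proof. by rewrite /diffop_mul msuppX big_seq1 mcoeffX eqxx scale1r. Qed.

Lemma diffop_mul0l Q : diffop_mul 0 Q = 0.
Proof. by rewrite /diffop_mul msupp0 big_nil. Qed.

Lemma diffop_mul_suml (I : Type) (r : seq I) (f : I -> poly2) Q :
  diffop_mul (\sum_(i <- r) f i) Q = \sum_(i <- r) diffop_mul (f i) Q.
Proof.
exact: (big_morph (diffop_mul^~ Q) (fun P1 P2 => diffop_mulDl P1 P2 Q)
  (diffop_mul0l Q)).
Qed.

Lemma diffop_mul1l : left_id 1 diffop_mul.
Proof. by move=> Q; rewrite -mpolyX0 diffop_mulXl lmulm0. Qed.

Lemma diffop_mul1r : right_id 1 diffop_mul.
Proof.
move=> P; rewrite [RHS]mpolyE; apply: eq_bigr => m _.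
by rewrite lmulm1.
Qed.

Lemma diffop_mul_lmulx P Q : diffop_mul (lmulx P) Q = lmulx (diffop_mul P Q).
Proof.
rewrite [P]mpolyE raddf_sum !diffop_mul_suml raddf_sum; apply: eq_bigr => m _.
by rewrite /= lmulxZ lmulx_X diffop_mulDl !diffop_mulZl !diffop_mulXl lmulmUx
  lmulxZ.
Qed.

Lemma diffop_mul_lmuly P Q : diffop_mul (lmuly P) Q = lmuly (diffop_mul P Q).
Proof.
rewrite [P]mpolyE raddf_sum !diffop_mul_suml raddf_sum; apply: eq_bigr => m _.
by rewrite /= lmulyZ lmuly_X diffop_mulDl !diffop_mulZl !diffop_mulXl lmulmUy
  lmulyZ.
Qed.

Lemma diffop_mul_lmulm m P Q :
  diffop_mul (lmulm m P) Q = lmulm m (diffop_mul P Q).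
Proof.
rewrite /lmulm; elim: (m ix) => [|n IHn] /=; last first.
  by rewrite diffop_mul_lmulx IHn.
by elim: (m iy) => //= n IHn; rewrite diffop_mul_lmuly IHn.
Qed.

Lemma diffop_mulA : associative diffop_mul.
Proof.
move=> P Q R; rewrite {2}/diffop_mul diffop_mul_suml.
by apply: eq_bigr => m _; rewrite diffop_mulZl diffop_mul_lmulm.
Qed.

End DiffopMul.

HB.instance Definition _ (F : pdiffFieldType) := GRing.Lmodule.on (diffop F).

HB.instance Definition _ (F : pdiffFieldType) :=
  GRing.Zmodule_isNzRing.Build (diffop F) (@diffop_mulA F)
    (@diffop_mul1l F) (@diffop_mul1r F) (@diffop_mulDl F) (@diffop_mulDr F)
    (oner_neq0 {mpoly F[2]}).

HB.instance Definition _ (F : pdiffFieldType) :=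
  GRing.Lmodule_isLalgebra.Build F (diffop F)
    (fun c (P Q : diffop F) => esym (diffop_mulZl c P Q)).

Definition opx {F : pdiffFieldType} : diffop F := ('X_ix : {mpoly F[2]}).
Definition opy {F : pdiffFieldType} : diffop F := ('X_iy : {mpoly F[2]}).

Section DiffopTheory.
Variable F : pdiffFieldType.
Implicit Types (P : diffop F) (f : F).

Lemma opxE P : opx * P = lmulx P.
Proof.
have -> : opx * P = diffop_mul 'X_ix P by [].
by rewrite diffop_mulXl -[U_(ix)%MM]addm0 lmulmUx lmulm0.
Qed.

Lemma opyE P : opy * P = lmuly P.
Proof.
have -> : opy * P = diffop_mul 'X_iy P by [].
by rewrite diffop_mulXl -[U_(iy)%MM]addm0 lmulmUy lmulm0.
Qed.

Lemma opxyC : opx * opy = opy * opx :> diffop F.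
Proof. by rewrite opxE opyE lmulx_X lmuly_X addmC. Qed.

Lemma opxC f : opx * f%:A = f *: opx + (derx f)%:A :> diffop F.
Proof. by rewrite opxE lmulxZ -opxE mulr1. Qed.

Lemma opyC f : opy * f%:A = f *: opy + (dery f)%:A :> diffop F.
Proof. by rewrite opyE lmulyZ -opyE mulr1. Qed.

Lemma op_monomE (m : 'X_{1..2}) :
  opx ^+ m ix * opy ^+ m iy = ('X_[m] : {mpoly F[2]}) :> diffop F.
Proof.
rewrite -[RHS]lmulm1 /lmulm -[in LHS](mulr1 (opy ^+ _)).
have iterx n P : iter n (@lmulx F) P = opx ^+ n * P.
  by elim: n => [|n /= ->]; rewrite ?mul1r // exprS -mulrA opxE.
have itery n P : iter n (@lmuly F) P = opy ^+ n * P.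
  by elim: n => [|n /= ->]; rewrite ?mul1r // exprS -mulrA opyE.
by rewrite itery iterx.
Qed.

Lemma diffopE P :
  P = \sum_(m <- msupp P) P@_m *: (opx ^+ m ix * opy ^+ m iy).
Proof.
rewrite [LHS]mpolyE; apply: eq_bigr => m _.
by rewrite op_monomE.
Qed.

End DiffopTheory.

(** * Orders and symbols *)

Definition order_le (F : pdiffFieldType) (z : nat) (P : diffop F) : Prop :=
  (msize (P : {mpoly F[2]}) <= z.+1)%N.

Definition has_order (F : pdiffFieldType) (n : nat) (P : diffop F) : Prop :=
  msize (P : {mpoly F[2]}) = n.+1.

(* The variables v, w of the symbol are 'X_ix, 'X_iy. *)
Definition symb (F : pdiffFieldType) (P : diffop F) : {mpoly F[2]} :=
  pihomog mdeg (msize (P : {mpoly F[2]})).-1 P.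

Section LinearDivisors.
Variable F : fieldType.
Implicit Types (s l : {mpoly F[2]}).

Definition poly_dvd s1 s2 : Prop := exists q, s2 = q * s1.

Definition linear_form l : Prop := (l != 0) && (l \is 1.-homog).

(* Linear forms are considered up to nonzero constant factors. *)
Definition same_divisor l1 l2 : Prop := exists c : F, l1 = c *: l2.

Definition separable s : Prop :=
  forall l, linear_form l -> ~ poly_dvd (l ^+ 2) s.

Definition two_linear_divisors s : Prop :=
  exists l1 l2, [/\ linear_form l1, linear_form l2, ~ same_divisor l1 l2,
    poly_dvd (l1 ^+ 2) s & poly_dvd l2 s].

Definition single_linear_divisor s : Prop :=
  exists l, [/\ linear_form l, poly_dvd (l ^+ 3) s &
    forall l', linear_form l' -> poly_dvd l' s -> same_divisor l' l].

End LinearDivisors.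

(** * Left ideals and non-holonomicity *)

Section Ideals.
Variable F : pdiffFieldType.
Local Notation D := (diffop F).
Implicit Types (I J : set D) (P : D).
Local Open Scope classical_set_scope.

Definition left_ideal I : Prop :=
  [/\ I 0, forall P Q, I P -> I Q -> I (P + Q) & forall A P, I P -> I (A * P)].

Definition principal P : set D := [set A * P | A in [set: D]].

(* The image in D / I of the operators of order at most z has F-dimension d:
   the classes of some b_0, ..., b_(d-1) form a basis of it. *)
Definition dim_order_le_mod I (z d : nat) : Prop :=
  exists b : 'I_d -> D,
    [/\ forall k, order_le z (b k),
        forall c : 'I_d -> F, I (\sum_k c k *: b k) -> forall k, c k = 0
      & forall Q, order_le z Q ->
          exists c : 'I_d -> F, I (Q - \sum_k c k *: b k)].

Definition Hilbert_Kolchin I (h : {poly rat}) : Prop :=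
  exists N : nat, forall z : nat, (N <= z)%N ->
    exists2 d : nat, dim_order_le_mod I z d & h.[z%:R] = d%:R.

Definition non_holonomic I : Prop :=
  exists2 h : {poly rat}, Hilbert_Kolchin I h & size h = 2.

Definition non_holonomic_overideal J I : Prop :=
  [/\ left_ideal I, J `<=` I & non_holonomic I].

Definition max_non_holonomic_overideal J I : Prop :=
  non_holonomic_overideal J I /\
  forall I', non_holonomic_overideal J I' -> I `<=` I' -> I' = I.

Definition at_most_two (S : set (set D)) : Prop :=
  exists I1 I2 : set D, S `<=` [set I1; I2].

End Ideals.

(* Main.v *)
Require Import Defs.
From HB Require Import structures.
From mathcomp Require Import all_boot all_order all_algebra.
From mathcomp Require Import boolp classical_sets functions cardinality.
From mathcomp Require Import mpoly generic_quotient zify ring lra.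

Set Implicit Arguments.
Unset Strict Implicit.
Unset Printing Implicit Defensive.

Import Order.TTheory GRing.Theory Num.Theory.
Local Open Scope classical_set_scope.
Local Open Scope ring_scope.

(** Let A be the ring F[Y] of ordinary operators in one of the two derivations
    and X the other derivation, so that F[d_x, d_y] = A[X] is a skew polynomial
    ring over the left Ore domain A.

    Elimination.  A left ideal that contains a nonzero operator has a
    Hilbert-Kolchin polynomial of degree at most one, because its standard
    monomials form a staircase that misses a point ([Hilbert_Kolchin_linear]).
    The degree is one as soon as the ideal meets one of the two rings of ordinary
    operators only in 0 ([non_holonomic_disjoint]).  Conversely, if P has an
    invertible leading coefficient in X, an overideal of <P> that contains a
    nonzero element of A has finite codimension ([fin_codim_meets]), hence is not
    non-holonomic.  Over the skew field of fractions of A every left ideal of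
    A[X] would be principal; pseudo-division by an element of least X-degree
    ([minimal_division]) takes the place of this localization.  A maximal
    non-holonomic overideal I of <P> is A-saturated ([max_saturated]), so it is
    determined by any of its elements of least X-degree ([sub_saturated]); and if
    P is monic in X of degree n, up to a factor in F, every element of I outside
    <P> yields a nonzero element of I of X-degree less than n
    ([reduce_unit_lead]).

    Newton polygons.  For positive weights of d_x and d_y the part of highest
    weight is multiplicative, since moving a derivation past a coefficient lowers
    the weight ([lead_formM]).  If the weight of Y is even and that of X is odd,
    the two terms of an operator a X + b with a, b in A have different weights,
    so its leading form is a monomial.  If the leading form of P vanishes at some
    point with nonzero coordinates, no product s P with s <> 0 in A is therefore a
    product of such operators ([newton_factor]).  With weights 2, 1 or 3, 2 of
    d_x, d_y this applies to w^2 v + p0 v^2, to w^3 + p2 v w and to w^3 + p0 v^2.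

    The finite cases.  For a double divisor, two distinct maximal overideals
    share no element of d_x-degree one, and P has d_x-degree two; hence they meet
    in <P>.  At most one of them contains a nonzero element of F[d_x], for
    otherwise <P> would contain one.  At most one does not: by the Newton polygon
    such an ideal has P as an element of least d_y-degree.  For a triple divisor
    with p0 = 0 and p2 <> 0 the roles are exchanged, P having d_y-degree three,
    and the Newton polygon excludes a chain of ideals with least d_y-degrees
    1, 2, 3.  In the two remaining finite cases no maximal overideal differs from
    <P>.

    The infinite case.  If P is an operator in d_y alone, every solution e <> 0
    of P e = 0 gives the overideal generated by d_y - e'/e, which is maximal.
    Infinitely many of these logarithmic derivatives e'/e are obtained in F from
    its differential closedness: for each N, a system asking for N solutions with
    nonzero Wronskians is solvable in the fraction field of F[[t]], on which d_y
    acts by its action on the coefficients plus d/dt ([ode_solutions]). *)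

(** * Skew polynomials over a left Ore domain *)

Section SkewPolynomials.
Variables (D : nzRingType).
Implicit Types (A : D -> Prop) (X a b s t P Q L B C : D).

Definition is_subring A : Prop :=
  [/\ A 1, forall a b, A a -> A b -> A (a - b)
    & forall a b, A a -> A b -> A (a * b)].

Definition left_Ore A : Prop := forall s t, A s -> A t -> t != 0 ->
  exists e f, [/\ A e, A f, e != 0 & e * s = f * t].

(** Polynomials of degree less than n with coefficients on the left. The
    recursion peels off the term of degree n - 1, whose coefficient may
    vanish. *)
Fixpoint poly_lt A X (n : nat) P : Prop :=
  if n is k.+1 then exists a Q, [/\ A a, poly_lt A X k Q & P = a * X ^+ k + Q]
  else P = 0.

Definition in_poly A X P : Prop := exists n, poly_lt A X n P.

(** The commutator is the value at a of a derivation of A, which remains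
    implicit. *)
Definition skew_var A X : Prop := forall a, A a -> A (X * a - a * X).

Hypothesis integralD : forall P Q, P * Q = 0 -> P = 0 \/ Q = 0.

Lemma mul_neq0 P Q : P != 0 -> Q != 0 -> P * Q != 0.
Proof.
by move=> /eqP nzP /eqP nzQ; apply/eqP => /integralD [].
Qed.

Variables (A : D -> Prop) (X : D).
Hypotheses (subA : is_subring A) (varX : skew_var A X).
Local Notation lt := (poly_lt A X).

Let A1 : A 1. Proof. by case: subA. Qed.
Let AB a b : A a -> A b -> A (a - b). Proof. by case: subA => _ + _; apply. Qed.
Let AM a b : A a -> A b -> A (a * b). Proof. by case: subA => _ _; apply. Qed.
Let A0 : A 0. Proof. by rewrite -(subrr 1); apply: AB. Qed.
Let AN a : A a -> A (- a). Proof. by rewrite -sub0r; apply: AB. Qed.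
Let AD a b : A a -> A b -> A (a + b).
Proof. by move=> Aa Ab; rewrite -[b]opprK; apply/AB/AN. Qed.

Lemma poly_lt0 n : lt n 0.
Proof.
elim: n => //= n IHn; exists 0, 0; split=> //; by rewrite mul0r addr0.
Qed.

Lemma poly_ltS n P : lt n P -> lt n.+1 P.
Proof. by move=> ltP; exists 0, P; rewrite mul0r add0r. Qed.

Lemma poly_lt_leq m n P : (m <= n)%N -> lt m P -> lt n P.
Proof.
move=> /subnKC <-; elim: (n - m)%N => [|k IHk] ltP; first by rewrite addn0.
by rewrite addnS; apply/poly_ltS/IHk.
Qed.

Lemma poly_ltD n P Q : lt n P -> lt n Q -> lt n (P + Q).
Proof.
elim: n P Q => [|n IHn] P Q /=; first by move=> -> ->; rewrite addr0.
move=> [a [P' [Aa ltP ->]]] [b [Q' [Ab ltQ ->]]].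
exists (a + b), (P' + Q'); split; [exact: AD|exact: IHn|].
by rewrite mulrDl addrACA.
Qed.

Lemma poly_ltMl n a P : A a -> lt n P -> lt n (a * P).
Proof.
move=> Aa; elim: n P => [|n IHn] P /=; first by move->; rewrite mulr0.
move=> [b [Q [Ab ltQ ->]]]; exists (a * b), (a * Q).
by split; [exact: AM|exact: IHn|rewrite mulrDr mulrA].
Qed.

Lemma poly_ltN n P : lt n P -> lt n (- P).
Proof. by rewrite -mulN1r; apply/poly_ltMl/AN. Qed.

Lemma poly_ltB n P Q : lt n P -> lt n Q -> lt n (P - Q).
Proof. by move=> ltP ltQ; apply/poly_ltD/poly_ltN. Qed.

Lemma poly_lt_term n a : A a -> lt n.+1 (a * X ^+ n).
Proof. by move=> Aa; exists a, 0; split=> //; [exact: poly_lt0|rewrite addr0]. Qed.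

Lemma poly_lt1 a : lt 1 a <-> A a.
Proof.
split=> [[b [_ [Ab -> ->]]]|Aa]; first by rewrite mulr1 addr0.
by rewrite -[a]mulr1; apply: (@poly_lt_term 0).
Qed.

Lemma poly_ltX n P : lt n P -> lt n.+1 (X * P).
Proof.
elim: n P => [|n IHn] P /=.
  by move->; rewrite mulr0; exact: (@poly_lt0 1).
move=> [a [Q [Aa ltQ ->]]]; exists a, ((X * a - a * X) * X ^+ n + X * Q).
split=> //; last first.
  by rewrite mulrDr addrA exprS !mulrA mulrBl addrCA subrr addr0.
apply: (@poly_ltD n.+1); last exact: IHn.
by apply/poly_lt_term/varX.
Qed.

Lemma poly_ltXn n k P : lt n P -> lt (k + n) (X ^+ k * P).
Proof.
elim: k => [|k IHk] ltP; first by rewrite mul1r.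
by rewrite exprS -mulrA; apply/poly_ltX/IHk.
Qed.

Lemma poly_ltMXn n k P : lt n P -> lt (n + k) (P * X ^+ k).
Proof.
elim: n P => [|n IHn] P /=; first by move->; rewrite mul0r; apply: poly_lt0.
move=> [a [Q [Aa ltQ ->]]]; exists a, (Q * X ^+ k).
by split=> //; [exact: IHn|rewrite mulrDl -mulrA exprD].
Qed.

Lemma poly_lt_commute k a : A a -> lt k (X ^+ k * a - a * X ^+ k).
Proof.
move=> Aa; elim: k => [|k IHk]; first by rewrite mul1r mulr1 subrr.
have -> : X ^+ k.+1 * a - a * X ^+ k.+1 =
   X * (X ^+ k * a - a * X ^+ k) + (X * a - a * X) * X ^+ k.
  by rewrite mulrBr mulrBl !exprS -!mulrA addrA subrK.
by apply/poly_ltD; [exact: poly_ltX|apply/poly_lt_term/varX].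
Qed.

Lemma poly_lead n P : lt n P -> P != 0 ->
  exists k a Q, [/\ (k < n)%N, A a, a != 0, lt k Q & P = a * X ^+ k + Q].
Proof.
elim: n P => [|n IHn] P /=; first by move->; rewrite eqxx.
move=> [a [Q [Aa ltQ ->]]].
have [-> nzP|nza nzP] := eqVneq a 0; last by exists n, a, Q; split.
rewrite mul0r add0r in nzP *.
have [k [b [Q' [ltkn Ab nzb ltQ' ->]]]] := IHn _ ltQ nzP.
by exists k, b, Q'; split=> //; apply: ltnW.
Qed.

(** Successive elimination of leading terms. The coefficient l need not divide
    the leading coefficient b to be cancelled, so both are first brought to a
    common left multiple e b = f l; the denominators e are drawn from S, which
    is {1} for an invertible l and the set of nonzero elements for an Ore
    domain. *)
Lemma skew_division (S : D -> Prop) r k l L B :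
  S 1 -> (forall a b, S a -> S b -> S (a * b)) -> (forall a, S a -> A a) ->
  (forall b, A b -> exists e f, [/\ S e, A f & e * b = f * l]) ->
  A l -> lt r L -> lt (r + k) B ->
  exists s C, [/\ S s, lt k C & lt r (s * B - C * (l * X ^+ r + L))].
Proof.
move=> S1 SM SA OreS Al ltL; elim: k B => [|k IHk] B ltB.
  exists 1, 0; split=> //.
  by rewrite mul1r mul0r subr0 -[r]addn0.
move: ltB; rewrite addnS /= => -[b [B' [Ab ltB' ->]]].
have [e [f [Se Af ebfl]]] := OreS _ Ab.
pose B1 := e * (b * X ^+ (r + k) + B') - f * X ^+ k * (l * X ^+ r + L).
have ltB1 : lt (r + k) B1.
  have -> : B1 = e * B' - f * (X ^+ k * L)
                 - f * ((X ^+ k * l - l * X ^+ k) * X ^+ r).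
    rewrite /B1 !mulrDr !mulrBl mulrBr !mulrA ebfl -!mulrA -exprD [(k + r)%N]addnC.
    by rewrite !opprD !opprK !addrA [LHS](ACl (2*4*3*1)%AC).
  apply: poly_ltB; first apply: poly_ltB.
  - exact/poly_ltMl/ltB'/SA.
  - by rewrite addnC; apply/poly_ltMl/poly_ltXn.
  by apply: poly_ltMl => //; rewrite addnC; apply/poly_ltMXn/poly_lt_commute.
have [s [C [Ss ltC ltr]]] := IHk _ ltB1.
exists (s * e), (C + s * f * X ^+ k); split.
- exact: SM.
- rewrite addrC; exists (s * f), C; split=> //; apply: AM => //; exact: SA.
by move: ltr; rewrite mulrBr mulrDl [C * _ + _]addrC opprD addrA !mulrA.
Qed.

Lemma unit_division r k l l' L B :
  A l -> A l' -> l' * l = 1 -> lt r L -> lt (r + k) B ->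
  exists2 C, lt k C & lt r (B - C * (l * X ^+ r + L)).
Proof.
move=> Al Al' l'l ltL ltB.
have [|||b Ab|s [C [-> ltC]]] :=
  @skew_division (fun s => s = 1) r k l L B _ _ _ _ Al ltL ltB => //.
- by move=> a b -> ->; rewrite mulr1.
- by move=> a ->.
- by exists 1, (b * l'); split=> //; [exact: AM|rewrite -mulrA l'l mulr1 mul1r].
by rewrite mul1r; exists C.
Qed.

Lemma in_polyD P Q : in_poly A X P -> in_poly A X Q -> in_poly A X (P + Q).
Proof.
move=> [n ltP] [k ltQ]; exists (maxn n k); apply: poly_ltD.
  exact: (poly_lt_leq (leq_maxl n k)).
exact: (poly_lt_leq (leq_maxr n k)).
Qed.

Lemma in_poly_subring : is_subring (in_poly A X).
Proof.
split; first by exists 1%N; apply/poly_lt1.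
  by move=> P Q inP [k ltQ]; apply: in_polyD => //; exists k; apply: poly_ltN.
move=> P Q [n ltP] [k ltQ].
elim: n P ltP => [|n IHn] P /=; first by move->; rewrite mul0r; exists 0.
move=> [a [P' [Aa ltP' ->]]]; rewrite mulrDl -mulrA; apply: in_polyD.
  by exists (n + k)%N; apply/poly_ltMl/poly_ltXn.
exact: IHn.
Qed.

Hypothesis OreA : left_Ore A.

Lemma pseudo_division r k l L B :
  A l -> l != 0 -> lt r L -> lt (r + k) B ->
  exists s C, [/\ A s, s != 0, lt k C & lt r (s * B - C * (l * X ^+ r + L))].
Proof.
move=> Al nzl ltL ltB.
have [|||b Ab|s [C [[As nzs] ltC ltr]]] :=
  @skew_division (fun s => A s /\ s != 0) r k l L B _ _ _ _ Al ltL ltB.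
- by split; rewrite ?oner_neq0.
- by move=> a b [Aa nza] [Ab nzb]; split; [exact: AM|exact: mul_neq0].
- by move=> a [].
- by have [e [f [Ae Af nze ebfl]]] := OreA Ab Al nzl; exists e, f.
by exists s, C.
Qed.

(** Euclid's algorithm: if R is the remainder of the pseudo-division of S by
    B, a common left multiple of B and R is one of B and S as well. *)
Lemma in_poly_Ore : left_Ore (in_poly A X).
Proof.
have [_ _ inM] := in_poly_subring.
have inA a : A a -> in_poly A X a by move=> Aa; exists 1%N; apply/poly_lt1.
move=> S B inS [n ltB]; elim/ltn_ind: n S B inS ltB => n IHn S B inS ltB nzB.
have [r [l [L [ltrn Al nzl ltL eqB]]]] := poly_lead ltB nzB.
have [k ltS] := inS.
have ltrkS : lt (r + k) S by apply/poly_lt_leq/ltS/leq_addl.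
have [s [C [As nzs ltC]]] := pseudo_division Al nzl ltL ltrkS.
rewrite -eqB; set R := s * S - C * B => ltR.
have inC : in_poly A X C by exists k.
have [R0|nzR] := eqVneq R 0.
  by exists s, C; split=> //; [exact: inA|apply/eqP; rewrite -subr_eq0 -/R R0].
have inB : in_poly A X B by exists n.
have [e [f [Pe Pf nze eBfR]]] := IHn r ltrn B R inB ltR nzR.
have nzf : f != 0.
  by apply: contraTneq (mul_neq0 nze nzB) => f0; rewrite eBfR f0 mul0r eqxx.
exists (f * s), (f * C + e); split.
- exact/inM/inA.
- by apply: in_polyD => //; apply: inM.
- exact: mul_neq0.
by rewrite mulrDl eBfR /R mulrBr !mulrA addrC subrK.
Qed.

End SkewPolynomials.

(** * Leading forms for weighted degrees *)

(** The monomial m is marked with T^(weight m): the T-degree of this image is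
    the weighted degree, and the map is a ring morphism for the commutative
    product of polynomials. *)
HB.lock Definition graded (F : pdiffFieldType) (w : 'I_2 -> nat)
    (P : {mpoly F[2]}) : {poly {mpoly F[2]}} :=
  mmap (polyC \o @mpolyC 2 F) (fun i => 'X_i *: 'X^(w i)) P.

Section LeadingForms.
Variables (F : pdiffFieldType) (w : 'I_2 -> nat).
Local Notation D := (diffop F).
Local Notation poly2 := {mpoly F[2]}.
Implicit Types (P Q : D) (m : 'X_{1..2}).

Definition weight m : nat := \sum_i w i * m i.

Local Notation graded := (@graded F w).

Lemma graded_zmod : zmod_morphism graded.
Proof. by rewrite unlock; exact: rmorphB. Qed.

HB.instance Definition _ :=
  GRing.isZmodMorphism.Build poly2 {poly poly2} graded graded_zmod.

Lemma graded_monoid : monoid_morphism graded.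
Proof. by rewrite unlock; split; [exact: rmorph1|exact: rmorphM]. Qed.

HB.instance Definition _ :=
  GRing.isMonoidMorphism.Build poly2 {poly poly2} graded graded_monoid.

Lemma gradedX m : graded 'X_[m] = 'X_[m] *: 'X^(weight m).
Proof.
rewrite unlock mmapX /mmap1 mpolyXE_id /weight.
elim/big_ind3: _ => [|p1 p2 p3 q1 q2 q3 -> ->|i _].
- by rewrite expr0 scale1r.
- by rewrite -scalerAl -scalerAr scalerA exprD.
by rewrite exprZn -exprM.
Qed.

Lemma gradedZ c P : graded (c *: P) = c%:MP *: graded P.
Proof. by rewrite -mul_mpolyC rmorphM /= {1}unlock mmapC /= mul_polyC. Qed.

Lemma gradedE P :
  graded P = \sum_(m <- msupp P) (P@_m *: 'X_[m]) *: 'X^(weight m).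
Proof.
rewrite {1}[P]mpolyE raddf_sum; apply: eq_bigr => m _.
by rewrite /= gradedZ gradedX scalerA mul_mpolyC.
Qed.

Lemma mcoeff_graded P d m :
  ((graded P)`_d)@_m = if weight m == d then P@_m else 0.
Proof.
rewrite gradedE coef_sum [in RHS](mpolyE P) !raddf_sum.
have -> (b : bool) (x : F) : (if b then x else 0) = x *+ b by case: b.
rewrite -sumrMnl; apply: eq_bigr => m' _.
rewrite /= coefZ coefXn eq_sym.
have -> : (P@_m' *: 'X_[m'])@_m = P@_m' * (m' == m)%:R by rewrite mcoeffZ mcoeffX.
have [<-|ne_wt] := eqVneq (weight m') d.
  rewrite mulr1 mcoeffZ mcoeffX; have [->|_] := eqVneq m' m.
    by rewrite eqxx.
  by rewrite mulr0 mul0rn.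
rewrite mulr0 mcoeff0; have [<-|_] := eqVneq m' m.
  by rewrite (negbTE ne_wt).
by rewrite mulr0 mul0rn.
Qed.

(** Acting on the coefficients leaves the monomials in place. *)
Lemma graded_map (d : {additive F -> F}) P :
  (size (graded (map_mpoly d P)) <= size (graded P))%N.
Proof.
apply/leq_sizeP => k lek; apply/mpolyP => m.
rewrite mcoeff_graded mcoeff_map_mpoly mcoeff0.
have := mcoeff_graded P k m; rewrite nth_default // mcoeff0.
by case: eqP => // _ <-; rewrite raddf0.
Qed.

Lemma graded_eq0 P : (graded P == 0) = (P == 0).
Proof.
apply/eqP/eqP => [g0|->]; last exact: raddf0.
apply/mpolyP => m; rewrite mcoeff0.
by have := mcoeff_graded P (weight m) m; rewrite eqxx g0 coef0 mcoeff0.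
Qed.

Lemma weight_lt_size P m : m \in msupp P -> (weight m < size (graded P))%N.
Proof.
move=> suppm; rewrite ltnNge; apply/negP => le_wt.
have := mcoeff_graded P (weight m) m; rewrite eqxx nth_default // mcoeff0.
by move/esym/eqP; rewrite mcoeff_eq0 suppm.
Qed.

Lemma gradedD P Q : graded (P + Q) = graded P + graded Q.
Proof. exact: (raddfD graded). Qed.

Lemma graded0 : graded 0 = 0.
Proof. exact: (raddf0 graded). Qed.

Let defect P Q : {poly poly2} := graded (P * Q) - graded P * graded Q.

(** The weight of P is at most d, and the defect of P Q stays below the weight
    d plus the weight of Q. This is stable under sums and products, hence
    follows for all operators once it holds for the two derivations. *)
Let small d P : Prop := (size (graded P) <= d.+1)%N /\
  forall Q, (size (defect P Q) <= d + (size (graded Q)).-1)%N.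

Let small_leq d e P : (d <= e)%N -> small d P -> small e P.
Proof.
move=> lede [szP errP]; split=> [|Q]; first exact: (leq_trans szP).
by apply: leq_trans (errP Q) _; rewrite leq_add2r.
Qed.

Let smallD d P Q : small d P -> small d Q -> small d (P + Q).
Proof.
move=> [szP errP] [szQ errQ]; split=> [|R].
  by rewrite gradedD (leq_trans (size_polyD _ _)) // geq_max szP.
have -> : defect (P + Q) R = defect P R + defect Q R.
  by rewrite /defect mulrDl !gradedD mulrDl opprD addrACA.
by rewrite (leq_trans (size_polyD _ _)) // geq_max errP errQ.
Qed.

Let smallZ d c P : small d P -> small d (c *: P).
Proof.
move=> [szP errP]; split=> [|R].
  by rewrite gradedZ -mul_polyC (leq_trans (size_mul_leq _ _)) //;
     rewrite (leq_trans _ szP) // size_polyC; case: eqP => //= _; rewrite leq_pred.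
have -> : defect (c *: P) R = c%:MP *: defect P R.
  by rewrite /defect -scalerAl !gradedZ -scalerAl scalerBr.
by rewrite (leq_trans (size_scale_leq _ _)).
Qed.

Let size_mul_le (p q : {poly poly2}) a b :
  (size p <= a.+1)%N -> (size q <= b)%N -> (size (p * q)%R <= a + b)%N.
Proof.
move=> szp szq; have [->|nzq] := eqVneq q 0; first by rewrite mulr0 size_poly0.
apply: leq_trans (size_polyMleq _ _) _.
by rewrite -ltnS prednK ?addn_gt0 ?size_poly_gt0 ?nzq ?orbT // -addSn leq_add.
Qed.

Let size_add_le (p q : {poly poly2}) a :
  (size p <= a)%N -> (size q <= a)%N -> (size (p + q)%R <= a)%N.
Proof.
by move=> szp szq; apply: leq_trans (size_polyD _ _) _; rewrite geq_max szp.
Qed.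

(** Associativity of both products gives defect(P Q, R) = defect(P, Q R) +
    gr(P) defect(Q, R) - defect(P, Q) gr(R). *)
Let smallM d e P Q : small d P -> small e Q -> small (d + e) (P * Q).
Proof.
move=> [szP errP] [szQ errQ].
have predQ : ((size (graded Q)).-1 <= e)%N by case: (size _) szQ.
have szerrPQ : (size (defect P Q) <= d + e)%N.
  by apply: leq_trans (errP Q) _; rewrite leq_add2l.
split=> [|R].
  have -> : graded (P * Q) = defect P Q + graded P * graded Q by rewrite subrK.
  by rewrite -addnS; apply: size_add_le;
     [apply: leq_trans szerrPQ _; rewrite addnS leqnSn | apply: size_mul_le].
have [->|nzR] := eqVneq R 0.
  by rewrite /defect mulr0 graded0 mulr0 subr0 size_poly0.
have gR : (0 < size (graded R))%N by rewrite size_poly_gt0 graded_eq0.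
have [r eqR] : exists r, size (graded R) = r.+1.
  by exists (size (graded R)).-1; rewrite prednK.
have szR : (size (graded R) <= r.+1)%N by rewrite eqR.
have := errQ R; rewrite eqR /= => szerrQR.
have -> : defect (P * Q) R = defect P (Q * R) + graded P * defect Q R - defect P Q * graded R.
  rewrite /defect -mulrA mulrBr mulrBl opprB !addrA subrK !mulrA.
  by rewrite [RHS](ACl (1*4*2*3)%AC)/= subrK.
have szQR : (size (graded (Q * R)) <= (e + r).+1)%N.
  have -> : graded (Q * R) = defect Q R + graded Q * graded R by rewrite subrK.
  by apply: size_add_le; [apply: leqW | rewrite -addnS; apply: size_mul_le].
rewrite -addnA; apply: size_add_le; first apply: size_add_le.
- apply: leq_trans (errP _) _; rewrite leq_add2l.
  by case: (size _) szQR.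
- exact: size_mul_le.
rewrite size_polyN mulrC addnA [(_ + r)%N]addnC; apply: size_mul_le => //.
Qed.

Hypothesis w_gt0 : forall i, (0 < w i)%N.

Lemma gradedU i : graded 'X_i = 'X_i *: 'X^(w i).
Proof. by rewrite unlock mmapX mmap1U. Qed.

(** The defect of X Q is the image of Q under the derivation of its
    coefficients, of no larger weight than Q; positivity of the weight of X
    makes it small. *)
Let small_var (d : {additive F -> F}) i (Y : D) :
  Y = 'X_i :> poly2 ->
  (forall Q, Y * Q = ('X_i : poly2) * (Q : poly2) + map_mpoly d Q :> poly2) ->
  small (w i) Y.
Proof.
move=> eY mY; split=> [|Q].
  by rewrite eY gradedU (leq_trans (size_scale_leq _ _)) // size_polyXn.
have -> : defect Y Q = graded (map_mpoly d Q).
  rewrite /defect mY (raddfD graded) /= (rmorphM graded) /= eY.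
  by rewrite addrAC subrr add0r.
apply: leq_trans (graded_map d Q) _; apply: leq_trans (leqSpred _) _.
by rewrite -add1n leq_add2r.
Qed.

Let smallX d k P : small d P -> small (k * d) (P ^+ k).
Proof.
move=> smP; elim: k => [|k IHk]; last by rewrite exprS mulSn; apply: smallM.
have g1 : graded (1 : D) = 1 by exact: (rmorph1 graded).
split=> [|Q]; first by rewrite g1 size_poly1.
by rewrite /defect mul1r g1 mul1r subrr size_poly0.
Qed.

Let small_size P : small (size (graded P)).-1 P.
Proof.
have smx : small (w ix) opx.
  by apply: (@small_var (@derx F)) => // Q; rewrite opxE.
have smy : small (w iy) opy.
  by apply: (@small_var (@dery F)) => // Q; rewrite opyE.
rewrite {2}[P]diffopE; have le_size m : m \in msupp P ->
    (m ix * w ix + m iy * w iy <= (size (graded P)).-1)%N.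
  move=> /weight_lt_size; rewrite /weight !big_ord_recl big_ord0 addn0.
  have -> : lift ord0 ord0 = iy by apply/val_inj.
  have -> : ord0 = ix by apply/val_inj.
  by rewrite mulnC [(w iy * _)%N]mulnC; case: (size _).
rewrite big_seq_cond; elim/big_ind: _ => [||m /andP[suppm _]].
- by split=> [|Q]; rewrite /defect ?mul0r graded0 ?mul0r ?subr0 size_poly0.
- by move=> Q R; apply: smallD.
apply/(small_leq (le_size m suppm))/smallZ.
by apply: smallM; apply: smallX.
Qed.

Definition lead_form P : poly2 := lead_coef (graded P).
Definition degree P : nat := (size (graded P)).-1.

Lemma lead_form_eq0 P : (lead_form P == 0) = (P == 0).
Proof. by rewrite lead_coef_eq0 graded_eq0. Qed.

Lemma size_graded P : P != 0 -> size (graded P) = (degree P).+1.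
Proof. by move=> nzP; rewrite prednK // size_poly_gt0 graded_eq0. Qed.

Lemma gradedM P Q : P != 0 -> Q != 0 ->
  exists2 r : {poly poly2}, graded (P * Q) = graded P * graded Q + r
    & (size r < size (graded P * graded Q)%R)%N.
Proof.
move=> nzP nzQ; exists (defect P Q); first by rewrite addrC subrK.
rewrite size_mul ?graded_eq0 // !size_graded // addnS /= addSn ltnS.
by have [_ /(_ Q)] := small_size P.
Qed.

(** Moving a derivation past a coefficient lowers the weight, so the parts of
    highest weight multiply as commutative polynomials. *)
Lemma lead_formM P Q : lead_form (P * Q) = lead_form P * lead_form Q.
Proof.
have [->|nzP] := eqVneq P 0; first by rewrite mul0r /lead_form graded0 lead_coef0 mul0r.
have [->|nzQ] := eqVneq Q 0; first by rewrite mulr0 /lead_form graded0 lead_coef0 mulr0.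
have [r eqr ltr] := gradedM nzP nzQ.
by rewrite /lead_form eqr lead_coefDl // lead_coefM.
Qed.

Lemma degreeM P Q : P != 0 -> Q != 0 -> degree (P * Q) = (degree P + degree Q)%N.
Proof.
move=> nzP nzQ; have [r eqr ltr] := gradedM nzP nzQ.
rewrite {1}/degree eqr size_polyDl // size_mul ?graded_eq0 //.
by rewrite !size_graded // addnS.
Qed.

Lemma diffop_integral P Q : P * Q = 0 -> P = 0 \/ Q = 0.
Proof.
move/eqP; rewrite -lead_form_eq0 lead_formM mulf_eq0 !lead_form_eq0.
by case/orP => /eqP; [left|right].
Qed.

End LeadingForms.

(** * Ordinary operators and Newton polygons *)

Section OneVariable.
Variable F : pdiffFieldType.
Local Notation D := (diffop F).
Implicit Types (b : bool) (f : F) (P Q B C s : D).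

Definition var_index b : 'I_2 := if b then ix else iy.
Definition dvar b : D := if b then opx else opy.

Definition is_const P : Prop := exists f, P = f%:A.
(** The ring F[d_x] or F[d_y] of ordinary operators. *)
Definition ord_ops b : D -> Prop := in_poly is_const (dvar b).
Definition op_lt b n P : Prop := poly_lt (ord_ops (~~ b)) (dvar b) n P.

Lemma diffop_domain P Q : P * Q = 0 -> P = 0 \/ Q = 0.
Proof. exact: (@diffop_integral F (fun=> 1%N)). Qed.

Lemma scale_constE f P : f *: P = f%:A * P.
Proof. by rewrite mulr_algl. Qed.

Lemma const_neq0 f : (f%:A != 0 :> D) = (f != 0).
Proof. by rewrite scaler_eq0 oner_eq0 orbF. Qed.

Lemma const_inv f : f != 0 -> (f^-1)%:A * f%:A = 1 :> D.
Proof. by move=> nzf; rewrite mulr_algl scalerA mulVf // scale1r. Qed.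

Lemma is_const_subring : is_subring is_const.
Proof.
split; first by exists 1; rewrite scale1r.
  by move=> _ _ [f ->] [g ->]; exists (f - g); rewrite scalerBl.
by move=> _ _ [f ->] [g ->]; exists (f * g); rewrite mulr_algl scalerA.
Qed.

Lemma is_const_Ore : left_Ore is_const.
Proof.
move=> _ _ [f ->] [g ->]; rewrite const_neq0 => nzg.
exists 1, (f / g)%:A; split; [by exists 1; rewrite scale1r|by exists (f / g)| |].
  exact: oner_neq0.
by rewrite mul1r mulr_algl scalerA divfK.
Qed.

Lemma const_skew b : skew_var is_const (dvar b).
Proof.
move=> _ [f ->]; rewrite mulr_algl.
case: b; [exists (derx f); rewrite /dvar opxC | exists (dery f); rewrite /dvar opyC].
  by rewrite addrAC subrr add0r.
by rewrite addrAC subrr add0r.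
Qed.

Lemma ord_ops_subring b : is_subring (ord_ops b).
Proof. exact: in_poly_subring is_const_subring (const_skew b). Qed.

Lemma ord_ops_Ore b : left_Ore (ord_ops b).
Proof.
exact (in_poly_Ore diffop_domain is_const_subring (const_skew b) is_const_Ore).
Qed.

Lemma ord_ops_const b f : ord_ops b f%:A.
Proof.
by exists 1%N; apply/(poly_lt1 _ is_const_subring); exists f.
Qed.

Lemma ord_ops_dvar b : ord_ops b (dvar b).
Proof.
have lt1 : poly_lt is_const (dvar b) 1 1.
  by apply/(poly_lt1 _ is_const_subring); exists 1; rewrite scale1r.
by exists 2%N; have := poly_ltX is_const_subring (const_skew b) lt1; rewrite mulr1.
Qed.

Lemma dvarC b : dvar b * dvar (~~ b) = dvar (~~ b) * dvar b.
Proof. by case: b; rewrite /= opxyC. Qed.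

(** The two derivations commute, so only the coefficients in F contribute to
    the commutator. *)
Lemma ord_ops_skew b : skew_var (ord_ops (~~ b)) (dvar b).
Proof.
move=> P [n]; elim: n P => [|n IHn] P /=.
  by move->; rewrite mulr0 mul0r subrr; exists 0%N.
move=> [a [Q [ca ltQ ->]]].
have -> : dvar b * (a * dvar (~~ b) ^+ n + Q) - (a * dvar (~~ b) ^+ n + Q) * dvar b
  = (dvar b * a - a * dvar b) * dvar (~~ b) ^+ n + (dvar b * Q - Q * dvar b).
  have comm : dvar (~~ b) ^+ n * dvar b = dvar b * dvar (~~ b) ^+ n.
    by apply/esym/commrX/dvarC.
  rewrite mulrDr mulrDl opprD addrACA; congr (_ + _).
  by rewrite mulrBl -!mulrA comm.
apply: (in_polyD is_const_subring); last exact: IHn.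
by exists n.+1; apply/(poly_lt_term _ is_const_subring)/const_skew.
Qed.

Lemma op_lt_total b P : exists n, op_lt b n P.
Proof.
have sub := in_poly_subring (ord_ops_subring (~~ b)) (@ord_ops_skew b).
have [_ _ inM] := sub.
have inA a : ord_ops (~~ b) a -> in_poly (ord_ops (~~ b)) (dvar b) a.
  by move=> Aa; exists 1%N; apply/(poly_lt1 _ (ord_ops_subring _)).
have inX : in_poly (ord_ops (~~ b)) (dvar b) (dvar b).
  exists 2%N; rewrite -[X in poly_lt _ _ _ X]mul1r -[X in _ * X]expr1.
  by apply: (poly_lt_term _ (ord_ops_subring _)); case: (ord_ops_subring (~~ b)).
have inY := inA _ (ord_ops_dvar (~~ b)).
have inMX Q n : in_poly (ord_ops (~~ b)) (dvar b) Q ->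
    in_poly (ord_ops (~~ b)) (dvar b) (Q ^+ n).
  by move=> inQ; elim: n => [|n IHn]; [case: sub|rewrite exprS; apply: inM].
rewrite -/(in_poly _ _ _) [P]diffopE.
elim/big_ind: _ => [||m _]; first by exists 0%N.
  exact: (in_polyD (ord_ops_subring _)).
rewrite scale_constE; apply: (inM); first exact/inA/ord_ops_const.
by apply: inM; apply: inMX; case: {+}b inX inY.
Qed.

End OneVariable.

Section Newton.
Variables (F : pdiffFieldType) (w : 'I_2 -> nat).
Hypothesis w_gt0 : forall i, (0 < w i)%N.
Local Notation D := (diffop F).
Implicit Types (b : bool) (f : F) (P Q B C s : D) (pt : 'I_2 -> F).
Local Notation lf := (lead_form w).
Local Notation deg := (degree w).

Lemma lead_form_addl P Q : P != 0 -> (Q == 0) || (deg Q < deg P)%N ->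
  lf (P + Q) = lf P /\ deg (P + Q) = deg P.
Proof.
move=> nzP ltQP; suff lt : (size (graded w Q) < size (graded w P))%N.
  by rewrite /lead_form /degree gradedD lead_coefDl // size_polyDl.
have [->|nzQ] := eqVneq Q 0; first by rewrite graded0 size_poly0 size_graded.
by move: ltQP; rewrite (negbTE nzQ) /= !size_graded // ltnS.
Qed.

Lemma lead_form_const f : lf f%:A = f%:MP /\ deg (f%:A)%R = 0%N.
Proof.
have -> : f%:A = f%:MP :> {mpoly F[2]}.
  by apply/mpolyP => m; rewrite mcoeffZ mcoeffC mcoeff1 .
rewrite /lead_form /degree.
have -> : graded w (f%:MP : {mpoly F[2]}) = (f%:MP)%:P.
  by rewrite unlock mmapC.
by rewrite lead_coefC size_polyC; case: (_ != 0).
Qed.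

Lemma lead_form_dvar b :
  lf (dvar F b) = 'X_(var_index b) /\ deg (dvar F b) = w (var_index b).
Proof.
rewrite /lead_form /degree.
have -> : graded w (dvar F b) = 'X_(var_index b) *: 'X^(w (var_index b)).
  by rewrite -gradedU; case: b.
rewrite lead_coefZ lead_coefXn mulr1 size_scale ?size_polyXn //.
by rewrite -msize_poly_eq0 msizeX.
Qed.

Lemma dvar_neq0 b : dvar F b != 0.
Proof.
rewrite -(lead_form_eq0 w); have [-> _] := lead_form_dvar b.
by rewrite -msize_poly_eq0 msizeX.
Qed.

Lemma dvarX_neq0 b n : dvar F b ^+ n != 0.
Proof.
elim: n => [|n IHn]; first exact: oner_neq0.
by rewrite exprS; apply: (mul_neq0 (@diffop_domain F)) => //; apply: dvar_neq0.
Qed.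

Lemma lead_form_dvarX b n :
  lf (dvar F b ^+ n) = 'X_(var_index b) ^+ n /\
  deg (dvar F b ^+ n) = (n * w (var_index b))%N.
Proof.
have [lfX degX] := lead_form_dvar b.
elim: n => [|n [IHlf IHdeg]].
  by have [] := lead_form_const 1; rewrite scale1r.
rewrite !exprS lead_formM // degreeM ?dvar_neq0 ?dvarX_neq0 //.
by rewrite lfX degX IHlf IHdeg mulSn.
Qed.

(** In a single variable distinct degrees have distinct weights, so the
    leading form is a monomial. *)
Lemma lead_form_ord b P : ord_ops b P -> P != 0 ->
  exists k c, [/\ c != 0, lf P = c *: 'X_(var_index b) ^+ k
    & deg P = (k * w (var_index b))%N].
Proof.
move=> [n ltP] nzP.
suff [k [c [_ nzc lfP degP]]] : exists k c, [/\ (k < n)%N, c != 0,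
    lf P = c *: 'X_(var_index b) ^+ k & deg P = (k * w (var_index b))%N].
  by exists k, c.
elim: n P ltP nzP => [|n IHn] P /=; first by move->; rewrite eqxx.
move=> [_ [Q [[f ->] ltQ ->]]].
have [->|nzf] := eqVneq f 0.
  rewrite scale0r mul0r add0r => nzQ.
  have [k [c [ltkn nzc lfQ degQ]]] := IHn Q ltQ nzQ.
  by exists k, c; split=> //; apply: ltnW.
move=> _; have [[lff degf] [lfX degX]] := (lead_form_const f, lead_form_dvarX b n).
have nzT : f%:A * dvar F b ^+ n != 0.
  by apply: (mul_neq0 (@diffop_domain F)); rewrite ?const_neq0 ?dvarX_neq0.
have degT : deg (f%:A * dvar F b ^+ n) = (n * w (var_index b))%N.
  by rewrite degreeM ?const_neq0 ?dvarX_neq0 // degf degX.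
have ltQT : (Q == 0) || (deg Q < deg (f%:A * dvar F b ^+ n)%R)%N.
  have [//|nzQ] := eqVneq Q 0; rewrite degT.
  have [k [c [ltkn nzc lfQ ->]]] := IHn Q ltQ nzQ.
  by rewrite ltn_mul2r w_gt0.
exists n, f; have [-> ->] := lead_form_addl nzT ltQT.
by split; rewrite // lead_formM // lff lfX mul_mpolyC.
Qed.

Variable pt : 'I_2 -> F.

Lemma eval_lead_ord b P : pt (var_index b) != 0 ->
  ord_ops b P -> P != 0 -> (lf P).@[pt] != 0.
Proof.
move=> ptb ordP nzP; have [k [c [nzc -> _]]] := lead_form_ord ordP nzP.
by rewrite mevalZ rmorphXn /= mevalXU mulf_neq0 // expf_neq0.
Qed.

(** The leading form of a multiple of P vanishes wherever that of P does,
    whereas a monomial in one variable does not vanish where this variable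
    does not. *)
Lemma newton_no_ord b s P C : pt (var_index b) != 0 ->
  (lf P).@[pt] = 0 -> ord_ops b s -> s != 0 -> s <> C * P.
Proof.
move=> ptb lfP0 ords nzs eq; have := eval_lead_ord ptb ords nzs.
by rewrite eq lead_formM // mevalM lfP0 mulr0 eqxx.
Qed.

Hypothesis pt_neq0 : forall i, pt i != 0.

(** Write B = a X + c with ordinary operators a and c. Their weights are even,
    so a X and c have weights of different parity, nothing cancels at the top,
    and the leading form of B is a monomial. *)
Lemma eval_lead_lt2 b B : ~~ odd (w (var_index (~~ b))) ->
  odd (w (var_index b)) -> op_lt b 2 B -> B != 0 -> (lf B).@[pt] != 0.
Proof.
move=> evenY oddX [a [Q [ordA ltQ ->]]].
have ordQ : ord_ops (~~ b) Q.
  exact: (proj1 (poly_lt1 (dvar F b) (ord_ops_subring F (~~ b)) Q) ltQ).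
have [->|nza] := eqVneq a 0; first by rewrite mul0r add0r; apply: (eval_lead_ord (pt_neq0 _) ordQ).
have nzT : a * dvar F b ^+ 1 != 0.
  by apply: (mul_neq0 (@diffop_domain F)); rewrite ?dvarX_neq0.
have evT : (lf (a * dvar F b ^+ 1)).@[pt] != 0.
  have [lfX _] := lead_form_dvarX b 1.
  rewrite lead_formM // mevalM mulf_neq0 ?(eval_lead_ord (pt_neq0 _) ordA) //.
  by rewrite lfX rmorphXn /= mevalXU expf_neq0.
have degT : odd (deg (a * dvar F b ^+ 1)).
  have [_ degX] := lead_form_dvarX b 1.
  rewrite degreeM ?dvarX_neq0 // degX mul1n oddD oddX.
  have [k [c [_ _ ->]]] := lead_form_ord ordA nza.
  by rewrite oddM (negbTE evenY) andbF.
have [->|nzQ] := eqVneq Q 0; first by rewrite addr0.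
have degQ : ~~ odd (deg Q).
  have [k [c [_ _ ->]]] := lead_form_ord ordQ nzQ.
  by rewrite oddM (negbTE evenY) andbF.
move=> _; case: (ltngtP (deg Q) (deg (a * dvar F b ^+ 1))) => [lt|lt|eq].
- by have [|-> _] := @lead_form_addl _ Q nzT; rewrite ?lt ?orbT.
- have [|lfQ _] := @lead_form_addl _ (a * dvar F b ^+ 1) nzQ; first by rewrite lt orbT.
  by rewrite addrC lfQ (eval_lead_ord (pt_neq0 _) ordQ).
by rewrite eq degT in degQ.
Qed.

(** If the leading form of P vanishes at pt, a nonzero multiple s P cannot
    split into operators of degree one: a left factor C of degree one has a
    leading form that is a monomial, so splitting it off leaves a cofactor B
    to which the same applies. *)
Lemma newton_factor b s P B C :
  ~~ odd (w (var_index (~~ b))) -> odd (w (var_index b)) ->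
  P != 0 -> s != 0 -> op_lt b 2 C -> s * P = C * B ->
  (lf B).@[pt] != 0 -> (lf P).@[pt] != 0.
Proof.
move=> evenY oddX nzP nzs ltC eq evB; have nzCB : C * B != 0.
  by rewrite -eq; apply: (mul_neq0 (@diffop_domain F)).
have nzC : C != 0 by apply: contraNneq nzCB => ->; rewrite mul0r.
have : (lf (s * P)).@[pt] != 0.
  by rewrite eq lead_formM // mevalM mulf_neq0 ?(eval_lead_lt2 evenY oddX ltC).
by rewrite lead_formM // mevalM mulf_eq0 negb_or => /andP[].
Qed.

End Newton.

(** * Hilbert-Kolchin polynomials *)

Section Staircase.
Implicit Types (s : nat -> nat -> bool) (f : nat -> nat).

Definition eventually_const f : Prop :=
  exists N c, forall z, (N <= z)%N -> f z = c.

Lemma eventually_const_sum n (f : 'I_n -> nat -> nat) :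
  (forall i, eventually_const (f i)) ->
  eventually_const (fun z => \sum_(i < n) f i z)%N.
Proof.
elim: n f => [|n IHn] f evf.
  by exists 0%N, 0%N => z _; rewrite big_ord0.
have [N1 [c1 H1]] := evf ord0.
have [N2 [c2 H2]] := IHn (fun i => f (lift ord0 i)) (fun i => evf _).
exists (maxn N1 N2), (c1 + c2)%N => z; rewrite geq_max => /andP[le1 le2].
by rewrite big_ord_recl H1 // H2.
Qed.

Lemma eventually_const_decr (f : nat -> bool) :
  (forall z, f z.+1 -> f z) -> eventually_const f.
Proof.
move=> decf; have [[N fN]|allf] := pselect (exists N, ~~ f N).
  exists N, 0%N => z /subnKC <-; elim: (z - N)%N => [|k IHk].
    by rewrite addn0 (negbTE fN).
  by rewrite addnS; case: (f _) (@decf (N + k)%N) IHk => //; case: (f _) => // ->.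
exists 0%N, 1%N => z _; case: (boolP (f z)) => // nfz.
by case: allf; exists z.
Qed.

Definition diagonal_count s (k : nat) : nat := (\sum_(i < k.+1) s i (k - i))%N.

(** A down-closed set that misses (a, b) lies in the union of the first a
    columns and the first b rows. On the k-th diagonal with k large these
    contribute separate points, and along each column or row membership can
    only be lost. *)
Lemma diagonal_count_eventually s a b :
  (forall i j, s i.+1 j -> s i j) -> (forall i j, s i j.+1 -> s i j) ->
  ~~ s a b -> eventually_const (diagonal_count s).
Proof.
move=> sL sR nsab.
have sLL i j k : s (k + i)%N j -> s i j by elim: k => // k IHk /sL.
have sRR i j k : s i (k + j)%N -> s i j by elim: k => // k IHk /sR.
have sab i j : s i j -> (a <= i)%N -> (j < b)%N.
  move=> sij /subnK eqi; rewrite ltnNge; apply: contra nsab => /subnK eqj.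
  by apply: (@sLL _ _ (i - a)%N); apply: (@sRR _ _ (j - b)%N); rewrite eqi eqj.
pose col (i : 'I_a) z : nat := s i (z - i)%N.
pose row (j : 'I_b) z : nat := s (z.+1 - b + j)%N (b - j.+1)%N.
have [|N1 [c1 H1]] := @eventually_const_sum a col.
  move=> i; apply: eventually_const_decr => z.
  have [lt|ge] := leqP i z; first by rewrite subSn // => /sR.
  by move/eqP: (ltnW ge) => ->; move: ge; rewrite -subn_eq0 => /eqP ->.
have [|N2 [c2 H2]] := @eventually_const_sum b row.
  move=> j; apply: eventually_const_decr => z.
  have [lt|ge] := leqP b z.+1; first by rewrite subSn // addSn => /sL.
  by move: (ge); rewrite -subn_eq0 => /eqP ->; move/ltnW: ge; rewrite -subn_eq0 => /eqP ->.
exists (maxn (a + b) (maxn N1 N2)), (c1 + c2)%N => z.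
rewrite !geq_max => /and3P[leab le1 le2].
rewrite -(H1 z) // -(H2 z) // /diagonal_count.
pose t := (z - (a + b))%N.
have eqz : z.+1 = (a + (t.+1 + b))%N.
  by rewrite addnCA addSn addnC [(a + b + t)%N]addnC subnK.
have -> : (\sum_(i < z.+1) s i (z - i)%N = \sum_(i < a + (t.+1 + b)) s i (z - i)%N)%N.
  by rewrite -eqz.
rewrite big_split_ord; congr (_ + _)%N.
rewrite big_split_ord /= big1 ?add0n => [|i _]; last first.
  apply/eqP; rewrite eqb0; apply/negP => /sab /(_ (leq_addr _ _)).
  by have := ltn_ord i; lia.
apply: eq_bigr => j _; rewrite /row; have := ltn_ord j => ltj.
by congr (s _ _ : nat); lia.
Qed.

End Staircase.

Section HilbertKolchin.
Variable F : pdiffFieldType.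
Local Notation D := (diffop F).
Local Notation poly2 := {mpoly F[2]}.
Implicit Types (I : set D) (P Q R : D) (m : 'X_{1..2}).

Section LeftIdeal.
Variable I : set D.
Hypothesis idI : left_ideal I.

Lemma ideal0 : I 0. Proof. by case: idI. Qed.
Lemma idealD P Q : I P -> I Q -> I (P + Q).
Proof. by case: idI => _ + _; apply. Qed.
Lemma idealM A P : I P -> I (A * P).
Proof. by case: idI => _ _; apply. Qed.
Lemma idealZ c P : I P -> I (c *: P).
Proof. by rewrite scale_constE; apply: idealM. Qed.
Lemma idealN P : I P -> I (- P).
Proof. by rewrite -mulN1r; apply: idealM. Qed.
Lemma idealB P Q : I P -> I Q -> I (P - Q).
Proof. by move=> IP IQ; apply/idealD/idealN. Qed.
Lemma ideal_sum (J : Type) (r : seq J) (p : pred J) (f : J -> D) :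
  (forall j, p j -> I (f j)) -> I (\sum_(j <- r | p j) f j).
Proof. by move=> If; elim/big_ind: _ => //; [exact: ideal0|exact: idealD]. Qed.

(** With fewer generators than elements, the matrix of coordinates has a
    nonzero row in its left kernel, which is a relation modulo I. *)
Lemma independent_le_spanning d N (b : 'I_d -> D) (g : 'I_N -> D) :
  (forall c : 'I_d -> F, I (\sum_k c k *: b k) -> forall k, c k = 0) ->
  (forall k, exists c : 'I_N -> F, I (b k - \sum_j c j *: g j)) ->
  (d <= N)%N.
Proof.
move=> indep /choice [M HM].
pose A := \matrix_(k < d, j < N) M k j.
rewrite leqNgt; apply/negP => ltNd.
have : kermx A != 0.
  rewrite -mxrank_eq0 mxrank_ker subn_eq0 -ltnNge.
  exact: leq_ltn_trans (rank_leq_col A) ltNd.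
case/rowV0Pn => u /sub_kermxP uA0 /eqP; apply.
apply/rowP => k; rewrite mxE.
apply: (indep (fun k => u 0 k)).
have -> : \sum_k u 0 k *: b k =
    \sum_k u 0 k *: (b k - \sum_j M k j *: g j).
  apply/eqP; rewrite -subr_eq0 -sumrB.
  under eq_bigr => i _ do rewrite -scalerBr subKr scaler_sumr.
  rewrite exchange_big big1 // => j _.
  under eq_bigr => i _ do rewrite scalerA.
  rewrite -scaler_suml; have -> : \sum_i u 0 i * M i j = (u *m A) 0 j.
    by rewrite mxE; apply: eq_bigr => i _; rewrite mxE.
  by rewrite uA0 mxE scale0r.
by apply: ideal_sum => i _; apply/idealZ/HM.
Qed.

Definition fin_codim : Prop :=
  exists N (g : 'I_N -> D), forall Q, exists c : 'I_N -> F,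
    I (Q - \sum_j c j *: g j).

(** The values of the Hilbert-Kolchin polynomial would be bounded, while a
    polynomial of degree one is unbounded. *)
Lemma fin_codim_holonomic : fin_codim -> ~ non_holonomic I.
Proof.
move=> [N [g spang]] [h [z0 HKh] szh].
have boundh z : (z0 <= z)%N -> exists2 d : nat, h.[z%:R] = d%:R & (d <= N)%N.
  move=> /HKh [d [b [_ indep _]] hz]; exists d => //.
  by apply: (independent_le_spanning indep) => k; apply: spang.
have ltN z : (z0 <= z)%N -> 0 <= h.[z%:R] <= N%:R.
  by move=> /boundh [d -> led]; rewrite ler0n ler_nat.
have [a [b nzb eqh]] : exists a, exists2 b, b != 0 & forall x : rat, h.[x] = a + b * x.
  exists h`_0, h`_1.
    by have := lead_coef_eq0 h; rewrite lead_coefE szh -size_poly_eq0 szh => ->.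
  by move=> x; rewrite horner_coef szh !big_ord_recl big_ord0 expr0 mulr1 addr0 expr1.
have /andP[z00 z0N] := ltN z0 (leqnn _).
have [M ltM] : exists M : nat, N%:R < `|b| * M%:R.
  have nzb' : 0 < `|b| by rewrite normr_gt0.
  exists (Num.bound (N%:R / `|b|)); rewrite mulrC -ltr_pdivrMr //.
  by apply: archi_boundP; rewrite divr_ge0.
have /andP[zM0 zMN] := ltN (z0 + M)%N (leq_addr _ _).
have : `|h.[(z0 + M)%:R] - h.[z0%:R]| = `|b| * M%:R.
  rewrite !eqh natrD mulrDr opprD addrACA subrr add0r [_ + b * M%:R]addrC addrK.
  by rewrite normrM normr_nat.
by move=> eqn; move: ltM; rewrite -eqn ltNge => /negP; apply;
   rewrite ler_norml; apply/andP; split; lra.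
Qed.

End LeftIdeal.
End HilbertKolchin.

Section StandardMonomials.
Variable F : pdiffFieldType.
Local Notation D := (diffop F).
Local Notation poly2 := {mpoly F[2]}.
Implicit Types (P Q R : D) (m : 'X_{1..2}).
Variable I : set D.
Hypothesis idI : left_ideal I.

Definition monom2 (i j : nat) : 'X_{1..2} := (U_(ix) *+ i + U_(iy) *+ j)%MM.

Lemma monom2E m : m = monom2 (m ix) (m iy).
Proof. exact: mnm2E. Qed.

Lemma monom2x i j : monom2 i j ix = i.
Proof. by rewrite mnmDE !mulmnE !mnm1E /= mul1n mul0n addn0. Qed.

Lemma monom2y i j : monom2 i j iy = j.
Proof. by rewrite mnmDE !mulmnE !mnm1E /= mul1n mul0n. Qed.

Lemma mdeg_monom2 i j : mdeg (monom2 i j) = (i + j)%N.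
Proof. by rewrite mdegD !mdegMn !mdeg1 !mul1n. Qed.

Definition lead_monom m : Prop := exists P, [/\ I P, P != 0 & mlead (P : poly2) = m].
(** Standard monomials for the degree-compatible order that underlies mlead;
    their classes will form a basis modulo I. *)
Definition standard (i j : nat) : bool := ~~ `[< lead_monom (monom2 i j) >].

(** The action of a derivation on the coefficients creates no monomial above
    the leading one, so the leading monomial of a product with d_x or d_y is
    the expected one. *)
Lemma mlead_var (d : {additive F -> F}) i (P : poly2) : P != 0 ->
  'X_i * P + map_mpoly d P != 0 /\
  mlead ('X_i * P + map_mpoly d P) = (U_(i) + mlead P)%MM.
Proof.
move=> nzP; have nzX : 'X_i != 0 :> poly2 by rewrite -msize_poly_eq0 msizeX.
have leadXP : mlead ('X_i * P) = (U_(i) + mlead P)%MM.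
  by rewrite mleadM // mleadXm.
have le_map : (mlead (map_mpoly d P) <= mlead P)%O.
  have [->|nzd] := eqVneq (map_mpoly d P) 0; first by rewrite mlead0 le0x.
  apply: msupp_le_mlead; move: (mlead_supp nzd).
  rewrite !mcoeff_msupp mcoeff_map_mpoly /=.
  by apply: contraNneq => ->; rewrite raddf0.
have lt_map : (mlead (map_mpoly d P) < mlead ('X_i * P))%O.
  rewrite leadXP; apply: le_lt_trans le_map _.
  by apply: lt_mdeg_ltmc; rewrite mdegD mdeg1 add1n.
have leadS := mleadDl lt_map; rewrite leadS leadXP; split=> //.
apply: contraTneq lt_map => S0; rewrite -leNgt.
by move: leadS; rewrite S0 mlead0 => <-; rewrite le0x.
Qed.

Lemma lead_monomS m i : lead_monom m -> lead_monom (U_(i) + m)%MM.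
Proof.
move=> [P [IP nzP <-]].
have [|eqi] : i = ix \/ i = iy.
- by case: i => -[|[|//]] lti; [left|right]; apply/val_inj.
- move=> ->; have [nz leadE] := @mlead_var (@derx F) ix P nzP.
  by exists (opx * P); rewrite opxE; split=> //; rewrite -opxE; apply: idealM.
rewrite eqi; have [nz leadE] := @mlead_var (@dery F) iy P nzP.
by exists (opy * P); rewrite opyE; split=> //; rewrite -opyE; apply: idealM.
Qed.

Lemma standard_left i j : standard i.+1 j -> standard i j.
Proof.
apply: contra => /asboolP /lead_monomS lm; apply/asboolP.
by have := lm ix; rewrite /monom2 addmA -mulmS.
Qed.

Lemma standard_down i j : standard i j.+1 -> standard i j.
Proof.
apply: contra => /asboolP /lead_monomS lm; apply/asboolP.
by have := lm iy; rewrite /monom2 addmA [(U_(iy) + _)%MM]addmC -addmA -mulmS.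
Qed.

(** The order refines the degree, so the reduction does not increase the order
    of operators. *)
Lemma standard_reduction z Q : order_le z Q -> exists T : D,
  [/\ I (Q - T), order_le z T & forall m, m \in msupp (T : poly2) -> standard (m ix) (m iy)].
Proof.
elim/mleadrect: Q => Q IHQ leQ.
have [->|nzQ] := eqVneq Q 0.
  exists 0; split; rewrite ?subrr; [exact: ideal0|by rewrite /order_le msize0|].
  by move=> m; rewrite msupp0.
have step (T : poly2) : order_le z T -> (mlead T <= mlead (Q : poly2))%O ->
    T@_(mlead (Q : poly2)) = (Q : poly2)@_(mlead (Q : poly2)) ->
    exists S : D, [/\ I (Q - T - S), order_le z S
      & forall m, m \in msupp (S : poly2) -> standard (m ix) (m iy)].
  move=> leT leadT cT.
  have leQT : order_le z ((Q : D) - (T : D)).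
    by apply: leq_trans (msizeD_le _ _) _; rewrite msizeN geq_max leQ.
  have [e|nzQT] := eqVneq ((Q : D) - (T : D)) 0.
    exists 0; rewrite e subrr; split; [exact: ideal0|by rewrite /order_le msize0|].
    by move=> m; rewrite msupp0.
  apply: IHQ => //; rewrite lt_neqAle; apply/andP; split.
    apply: contraNneq nzQT => eqm; rewrite -mleadc_eq0 eqm.
    by rewrite mcoeffB cT subrr.
  by apply: le_trans (mleadB_le _ _) _; rewrite leUx lexx.
(* A leading monomial of I is cancelled with an element of I; a standard one is
   moved to T. *)
have [lm|std] := boolP `[< lead_monom (mlead (Q : poly2)) >].
  move/asboolP: lm => [R [IR nzR leadR]].
  pose c := (Q : poly2)@_(mlead (Q : poly2)) / (R : poly2)@_(mlead (Q : poly2)).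
  have nzcR : (R : poly2)@_(mlead (Q : poly2)) != 0 by rewrite -leadR mleadc_eq0.
  have [||| S [IS leS stdS]] := step (c *: R).
  - rewrite /order_le; apply: leq_trans (msizeZ_le _ _) _.
    by move: leQ; rewrite /order_le -!mlead_deg // leadR.
  - by apply: le_trans (mleadZ_le _ _) _; rewrite leadR.
  - by rewrite mcoeffZ divfK.
  exists S; split=> //.
  have -> : (Q : D) - S = (Q - c *: R - S) + c *: R by rewrite addrAC subrK.
  by apply: idealD => //; apply: idealZ.
pose T : poly2 := (Q : poly2)@_(mlead (Q : poly2)) *: 'X_[mlead (Q : poly2)].
have leT : order_le z T.
  rewrite /order_le; apply: leq_trans (msizeZ_le _ _) _.
  by rewrite msizeX mlead_deg.
have [|| S [IS leS stdS]] := step T leT.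
- by apply: le_trans (mleadZ_le _ _) _; rewrite mleadXm.
- by rewrite mcoeffZ mcoeffX eqxx mulr1.
exists ((T : D) + S); split; first by rewrite opprD addrA.
  by apply: leq_trans (msizeD_le _ _) _; rewrite geq_max leT.
move=> m /msuppD_le; rewrite mem_cat => /orP[|/stdS //].
move=> /msuppZ_le; rewrite msuppX mem_seq1 => /eqP ->.
by rewrite /standard -monom2E.
Qed.

(** The pair (k, i) stands for the monomial d_x^i d_y^(k - i) of order k, so
    that the cardinal is a sum over diagonals. *)
Definition std_pairs z : {set 'I_z.+1 * 'I_z.+1} :=
  [set p : 'I_z.+1 * 'I_z.+1 | (p.2 <= p.1)%N && standard p.2 (p.1 - p.2)%N].

Lemma card_std_pairs z :
  #|std_pairs z| = (\sum_(k < z.+1) diagonal_count standard k)%N.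
Proof.
rewrite -sum1_card big_mkcond /=.
pose f (k i : 'I_z.+1) : nat := if (k, i) \in std_pairs z then 1%N else 0%N.
rewrite (eq_bigr (fun p => f p.1 p.2)) => [|[k i] _ //].
rewrite -(pair_bigA _ f) /=.
apply: eq_bigr => k _; rewrite /diagonal_count.
rewrite (big_ord_widen z.+1 (fun i => standard i (k - i) : nat)) ?ltn_ord //.
rewrite [RHS]big_mkcond; apply: eq_bigr => i _; rewrite /f inE /= ltnS.
by case: leqP => //= _; case: standard.
Qed.

Lemma dim_standard z : dim_order_le_mod I z #|std_pairs z|.
Proof.
pose mon (p : 'I_z.+1 * 'I_z.+1) := monom2 p.2 (p.1 - p.2)%N.
have mon_inj : {in std_pairs z &, injective mon}.
  move=> [k i] [k' i']; rewrite !inE /= => /andP[le _] /andP[le' _] eqm.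
  have eqi : i = i' :> nat by rewrite -(monom2x i (k - i)) [monom2 _ _]eqm monom2x.
  have eqk : (k - i = k' - i')%N by rewrite -(monom2y i (k - i)) [monom2 _ _]eqm monom2y.
  by congr (_, _); apply/val_inj => //=; lia.
pose b (k : 'I_#|std_pairs z|) : D := ('X_[mon (enum_val k)] : poly2).
have sum_bE (c : 'I_#|std_pairs z| -> F) : ((\sum_j c j *: b j : D) : poly2) =
    \sum_j c j *: 'X_[mon (enum_val j)] by [].
have coef_sum_b (c : 'I_#|std_pairs z| -> F) k :
    ((\sum_j c j *: b j : D) : poly2)@_(mon (enum_val k)) = c k.
  rewrite sum_bE.
  rewrite raddf_sum /= (bigD1 k) //= mcoeffZ mcoeffX eqxx mulr1 big1 ?addr0 //.
  move=> j nejk; rewrite mcoeffZ mcoeffX; case: eqP => [eqm|]; last by rewrite mulr0.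
  case/eqP: nejk; apply/enum_val_inj/mon_inj => //; exact: enum_valP.
exists b; split.
- move=> k; rewrite /order_le /b msizeX mdeg_monom2 ltnS.
  have := enum_valP k; rewrite inE => /andP[le _].
  by rewrite subnKC // -ltnS ltn_ord.
- move=> c Ic k; rewrite -(coef_sum_b c k).
  have [->|nz] := eqVneq (\sum_j c j *: b j) 0; first by rewrite mcoeff0.
  have := mlead_supp nz; rewrite {2}sum_bE.
  move=> /msupp_sum_le /flatten_mapP [j _ /msuppZ_le].
  rewrite msuppX mem_seq1 => /eqP eqlead.
  have := enum_valP j; rewrite inE => /andP[_ /negP]; case; apply/asboolP.
  by exists (\sum_j c j *: b j); split.
move=> Q /standard_reduction [T [IQT leT stdT]].
exists (fun k => (T : poly2)@_(mon (enum_val k))).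
suff <- : T = \sum_k (T : poly2)@_(mon (enum_val k)) *: b k by [].
apply/mpolyP => m; have [m_in|] := boolP (m \in msupp (T : poly2)); last first.
  rewrite -mcoeff_eq0 => /eqP Tm0; rewrite Tm0.
  rewrite sum_bE.
  rewrite raddf_sum big1 // => k _ /=; rewrite mcoeffZ mcoeffX.
  by case: eqP => [->|_]; rewrite ?Tm0 ?mul0r ?mulr0.
have degm : (mdeg m < z.+1)%N.
  by apply: leq_trans (msize_mdeg_lt m_in) leT.
have eqdeg : mdeg m = (m ix + m iy)%N by rewrite {1}[m]monom2E mdeg_monom2.
have ltx : (m ix < z.+1)%N by apply: leq_ltn_trans degm; rewrite eqdeg leq_addr.
pose p := (Ordinal degm, Ordinal ltx).
have p_in : p \in std_pairs z.
  by rewrite inE /= eqdeg leq_addr addKn stdT.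
have monp : mon p = m by rewrite [RHS]monom2E /mon /= eqdeg addKn.
have := coef_sum_b (fun k => (T : poly2)@_(mon (enum_val k))) (enum_rank_in p_in p).
by rewrite enum_rankK_in // monp.
Qed.

(** The standard monomials are down-closed and miss the leading monomial of P,
    so each sufficiently large order contributes the same number c of them. *)
Lemma Hilbert_Kolchin_linear P : I P -> P != 0 ->
  exists N c e : nat, forall z, (N <= z)%N ->
    exists2 d : nat, dim_order_le_mod I z d & d = (e + c * (z - N))%N.
Proof.
move=> IP nzP; have [|||N [c Hc]] := @diagonal_count_eventually standard
    (mlead (P : poly2) ix) (mlead (P : poly2) iy).
- exact: standard_left.
- exact: standard_down.
- by rewrite negbK; apply/asboolP; exists P; rewrite -monom2E.
exists N, c, #|std_pairs N| => z /subnKC <-.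
exists #|std_pairs (N + (z - N))%N|; first exact: dim_standard.
rewrite addKn; elim: (z - N)%N => [|k IHk]; first by rewrite addn0 muln0 addn0.
rewrite addnS card_std_pairs big_ord_recr -card_std_pairs IHk /=.
by rewrite Hc ?mulnS; lia.
Qed.

Definition meets_ord (b : bool) : Prop := exists s, [/\ ord_ops b s, s != 0 & I s].

Lemma dvarXE b k : dvar F b ^+ k =
  ('X_[if b then monom2 k 0 else monom2 0 k] : poly2) :> D.
Proof. by rewrite -op_monomE; case: b; rewrite /= monom2x monom2y ?mulr1 ?mul1r. Qed.

(** The powers of the derivation dvar b are independent modulo I, so the
    dimensions are unbounded and the slope c does not vanish. *)
Lemma non_holonomic_disjoint b P : I P -> P != 0 -> ~ meets_ord b -> non_holonomic I.
Proof.
move=> IP nzP Ib; have [N [c [e HN]]] := Hilbert_Kolchin_linear IP nzP.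
have nzc : c != 0%N.
  apply/eqP => c0; rewrite c0 in HN.
  have [d [g [_ _ spang]] eqd] := HN (N + e)%N (leq_addr _ _).
  rewrite mul0n addn0 in eqd.
  have sub := @is_const_subring F.
  pose y (k : 'I_(N + e).+1) : D := dvar F b ^+ k.
  suff : ((N + e).+1 <= d)%N by rewrite eqd ltnNge leq_addl.
  apply: (independent_le_spanning idI (b := y) (g := g)).
  - move=> a Ia k; have ord_sum : ord_ops b (\sum_j a j *: y j).
      elim/big_ind: _ => [||j _]; first by exists 0%N.
        exact: (in_polyD sub).
      rewrite scale_constE; exists j.+1.
      by apply: (poly_lt_term _ sub); exists (a j).
    have sum0 : \sum_j a j *: y j = 0.
      by apply/eqP/negP => /negP nz; apply: Ib; exists (\sum_j a j *: y j).
    pose mon (k : nat) := if b then monom2 k 0 else monom2 0 k.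
    have mon_inj : injective mon.
      rewrite /mon => i j; case: (b) => eqm.
        by rewrite -(monom2x i 0) eqm monom2x.
      by rewrite -(monom2y 0 i) eqm monom2y.
    have : ((\sum_j a j *: y j : D) : poly2)@_(mon k) = 0 by rewrite sum0 mcoeff0.
    have -> : ((\sum_j a j *: y j : D) : poly2) = \sum_j a j *: 'X_[mon j].
      by apply: eq_bigr => j _; rewrite /y dvarXE.
    rewrite raddf_sum /= (bigD1 k) //= mcoeffZ mcoeffX eqxx mulr1 big1 ?addr0 //.
    move=> j nejk; rewrite mcoeffZ mcoeffX; case: eqP => [/mon_inj eqm|]; last by rewrite mulr0.
    by case/eqP: nejk; apply/val_inj.
  - by move=> k; apply: spang; rewrite /order_le /y dvarXE msizeX;
       case: (b); rewrite mdeg_monom2 ?addn0 ?add0n ltn_ord.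
(* The count of standard monomials is e + c (z - N), with c <> 0. *)
pose h : {poly rat} := c%:R *: 'X + (e%:R - c%:R * N%:R)%:P.
exists h.
  exists N => z leNz; have [d dimd eqd] := HN z leNz; exists d => //.
  rewrite /h hornerD hornerZ hornerX hornerC eqd natrD natrM natrB //.
  by rewrite mulrBr addrCA addrA addrAC -addrA.
rewrite /h size_polyDl size_scale ?size_polyX ?pnatr_eq0 //.
by rewrite size_polyC; case: (_ != 0).
Qed.

(** A recursive form of membership in the span of g modulo I, convenient for
    concatenating spanning families. *)
Fixpoint span_mod (g : seq D) Q : Prop :=
  if g is x :: g' then exists c : F, span_mod g' (Q - c *: x) else I Q.

Lemma span_mod_ideal g P Q : I P -> span_mod g Q -> span_mod g (P + Q).
Proof.
move=> IP; elim: g Q => [|x g IHg] Q /=; first exact: idealD.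
by move=> [c /IHg]; rewrite addrA; exists c.
Qed.

Lemma span_mod_cat g1 g2 P Q :
  span_mod g1 P -> span_mod g2 Q -> span_mod (g1 ++ g2) (P + Q).
Proof.
elim: g1 P => [|x g IHg] P /=; first exact: span_mod_ideal.
by move=> [c sP] sQ; exists c; rewrite addrAC; apply: IHg.
Qed.

Lemma span_mod_fin_codim g : (forall Q, span_mod g Q) -> fin_codim I.
Proof.
move=> sg; exists (size g), (fun i => g`_i) => Q.
elim: g Q {sg}(sg Q) => [|x g IHg] Q /=.
  by exists (fun=> 0); rewrite big_ord0 subr0.
move=> [c /IHg [a Ia]].
exists (fun i => if unlift ord0 i is Some j then a j else c).
rewrite big_ord_recl unlift_none opprD addrA.
by under eq_bigr => i _ do rewrite liftK.
Qed.

(** Division by P bounds the degree in the derivation X = dvar b. An element s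
    of the ideal that is free of X bounds the degree in the other derivation
    Y: X^k s lies in the ideal and agrees with s X^k up to terms of lower
    degree in X. *)
Lemma fin_codim_meets b n l P P' :
  l != 0 -> P = l%:A * dvar F b ^+ n + P' -> op_lt b n P' -> I P ->
  meets_ord (~~ b) -> fin_codim I.
Proof.
move=> nzl eqP ltP' IP [s [ords nzs Is]].
have subA := ord_ops_subring F (~~ b).
have skA := @ord_ops_skew F b.
have cA (f : F) : ord_ops (~~ b) (f%:A : D) by apply: ord_ops_const.
have [d [_ [s' [[f ->] nzf lts' eqs]]]] :
    exists d a Q, [/\ is_const a, a != 0, poly_lt (@is_const F) (dvar F (~~ b)) d Q
      & s = a * dvar F (~~ b) ^+ d + Q].
  by case: (ords) => k /poly_lead /(_ nzs) [d [a [Q [_ ca nza ltQ ->]]]]; exists d, a, Q.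
rewrite const_neq0 in nzf.
pose low k := [seq dvar F (~~ b) ^+ i * dvar F b ^+ k | i <- rev (iota 0 d)].
have span_low k r : poly_lt (@is_const F) (dvar F (~~ b)) d r ->
    span_mod (low k) (r * dvar F b ^+ k).
  rewrite /low; elim: (d) r => [|e IHe] r.
    by move=> ->; rewrite mul0r; apply: ideal0.
  rewrite -[in iota 0 _](addn1 e) iotaD rev_cat /= => -[_ [r' [[c ->] ltr' ->]]].
  by exists c; rewrite mulrDl scale_constE mulrA addrC addKr; apply: IHe.
have span_lt k : exists g, forall Q, op_lt b k Q -> span_mod g Q.
  elim: k => [|k [g IHg]]; first by exists [::] => Q ->; apply: ideal0.
  exists (low k ++ g) => _ [a [Q [orda ltQ ->]]].
  have [j lta] := orda.
  have ltda : poly_lt (@is_const F) (dvar F (~~ b)) (d + j) a.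
    by apply: (poly_lt_leq (@is_const_subring F)) lta; apply: leq_addl.
  have [C ltC ltr] := unit_division (@is_const_subring F) (@const_skew F (~~ b))
    (ex_intro _ f erefl) (ex_intro _ f^-1 erefl) (const_inv nzf) lts' ltda.
  rewrite -eqs in ltr; set r := a - C * s in ltr.
  (* Division of a by s in A; C X^k s lies in I and differs from C s X^k by
     terms of lower degree in X. *)
  have -> : a * dvar F b ^+ k + Q = C * dvar F b ^+ k * s + (r * dvar F b ^+ k
      + (Q - C * (dvar F b ^+ k * s - s * dvar F b ^+ k))).
    rewrite /r mulrBl mulrBr !mulrA.
    by rewrite opprB addrACA addKr [RHS]addrC subrK.
  apply: span_mod_ideal; first exact: idealM.
  apply: span_mod_cat; first exact: span_low.
  apply: IHg; apply: (poly_ltB subA) => //; apply: (poly_ltMl subA); first by exists j.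
  exact: (poly_lt_commute subA skA).
have [g sg] := span_lt n; apply: (@span_mod_fin_codim g) => Q.
have [k ltQ] := op_lt_total b Q.
have ltnk : op_lt b (n + k) Q by apply: (poly_lt_leq subA) ltQ; apply: leq_addl.
have [C _ ltr] := unit_division subA skA (cA l) (cA l^-1) (const_inv nzl) ltP' ltnk.
have -> : Q = C * P + (Q - C * P) by rewrite addrC subrK.
by apply: span_mod_ideal; [exact: idealM|apply: sg; rewrite eqP].
Qed.

End StandardMonomials.

(** * Maximal non-holonomic overideals *)

Section Overideals.
Variable F : pdiffFieldType.
Local Notation D := (diffop F).
Implicit Types (I J : set D) (P Q B C L s : D) (b : bool).

Lemma principal_ideal P : left_ideal (principal P).
Proof.
split; first by exists 0; rewrite ?mul0r.
  by move=> _ _ [A _ <-] [B _ <-]; exists (A + B); rewrite ?mulrDl.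
by move=> A _ [B _ <-]; exists (A * B); rewrite ?mulrA.
Qed.

Lemma principal_self P : principal P P.
Proof. by exists 1; rewrite ?mul1r. Qed.

Lemma principal_sub P I : left_ideal I -> I P -> principal P `<=` I.
Proof. by move=> idI IP _ [A _ <-]; apply: idealM. Qed.

Lemma setI_ideal I J : left_ideal I -> left_ideal J -> left_ideal (I `&` J).
Proof.
move=> idI idJ; split; first by split; apply: ideal0.
  by move=> P Q [IP JP] [IQ JQ]; split; apply: idealD.
by move=> A P [IP JP]; split; apply: idealM.
Qed.

Definition unit_lead b n P : Prop := exists l P',
  [/\ l != 0, op_lt b n P' & P = l%:A * dvar F b ^+ n + P'].

Lemma unit_lead_lt b n P : unit_lead b n P -> op_lt b n.+1 P.
Proof.
by move=> [l [P' [_ ltP' ->]]]; exists (l%:A), P'; split=> //; apply: ord_ops_const.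
Qed.

(** Meeting the ring of ordinary operators means finite codimension. *)
Lemma unit_lead_disjoint b n P I : left_ideal I -> I P -> unit_lead b n P ->
  non_holonomic I -> ~ meets_ord I (~~ b).
Proof.
move=> idI IP [l [P' [nzl ltP' defP]]] nhI meetI.
exact: (fin_codim_holonomic idI (fin_codim_meets idI nzl defP ltP' IP meetI)).
Qed.

Definition free_below b n I : Prop := forall Q, op_lt b n Q -> I Q -> Q = 0.

(** For left ideals: I is the trace of an ideal of the localization at the
    nonzero ordinary operators in the other derivation. *)
Definition saturated b I : Prop :=
  forall s B, ord_ops (~~ b) s -> s != 0 -> I (s * B) -> I B.

Lemma disjoint_free I b : ~ meets_ord I (~~ b) -> free_below b 1 I.
Proof.
move=> nmI Q ltQ IQ; apply/eqP/negP => /negP nzQ; apply: nmI; exists Q; split=> //.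
exact: (proj1 (poly_lt1 (dvar F b) (ord_ops_subring F (~~ b)) Q) ltQ).
Qed.

(** The remainder of the division of B by P. *)
Lemma reduce_unit_lead b n P I B : left_ideal I -> I P -> unit_lead b n P ->
  I B -> ~ principal P B -> exists Q, [/\ I Q, Q != 0 & op_lt b n Q].
Proof.
move=> idI IP [l [P' [nzl ltP' defP]]] IB nB; have [k ltB] := op_lt_total b B.
have subA := ord_ops_subring F (~~ b).
have ltBk : op_lt b (n + k) B by apply: (poly_lt_leq subA) ltB; apply: leq_addl.
have cA (f : F) : ord_ops (~~ b) (f%:A : D) by apply: ord_ops_const.
have [C _] := unit_division subA (@ord_ops_skew F b) (cA l) (cA l^-1)
  (const_inv nzl) ltP' ltBk.
rewrite -defP => ltQ; exists (B - C * P); split=> //.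
  by apply: idealB => //; apply: idealM.
by apply/negP => /eqP /subr0_eq eqB; apply: nB; exists C.
Qed.

(** The remainder of the pseudo-division lies in I and has degree below the
    minimum, hence vanishes. *)
Lemma minimal_division b r k I B C : left_ideal I -> free_below b r I ->
  op_lt b r.+1 B -> B != 0 -> I B -> op_lt b (r + k) C -> I C ->
  exists s E, [/\ ord_ops (~~ b) s, s != 0, op_lt b k E & s * C = E * B].
Proof.
move=> idI freeI [l [L [Al ltL eqB]]] nzB IB ltC IC.
have subA := ord_ops_subring F (~~ b).
have nzl : l != 0.
  apply: contraNneq nzB => l0; apply/eqP/freeI => //.
  by rewrite eqB l0 mul0r add0r.
have [s [E [As nzs ltE]]] := pseudo_division (@diffop_domain F) subA (@ord_ops_skew F b)
  (@ord_ops_Ore F (~~ b)) Al nzl ltL ltC.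
rewrite -eqB => ltR; exists s, E; split=> //; apply/subr0_eq/freeI => //.
by apply: idealB => //; apply: idealM.
Qed.

(** Every C in I satisfies s C = E B for some nonzero ordinary s, so s C lies
    in J, and saturation gives C in J. *)
Lemma sub_saturated b r I J B : left_ideal I -> left_ideal J ->
  free_below b r I -> saturated b J -> op_lt b r.+1 B -> B != 0 ->
  I B -> J B -> I `<=` J.
Proof.
move=> idI idJ freeI satJ ltB nzB IB JB C IC; have [k ltC] := op_lt_total b C.
have ltCk : op_lt b (r + k) C.
  by apply: (poly_lt_leq (ord_ops_subring F _)) ltC; apply: leq_addl.
have [s [E [As nzs _ eqC]]] := minimal_division idI freeI ltB nzB IB ltCk IC.
by apply: (satJ s) => //; rewrite eqC; apply: idealM.
Qed.

(** Pseudo-division by an element of degree zero leaves no remainder; this is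
    the Ore condition for denominators. *)
Lemma ord_left_multiple b s C : ord_ops (~~ b) s -> s != 0 ->
  exists s' C', [/\ ord_ops (~~ b) s', s' != 0 & s' * C = C' * s].
Proof.
move=> As nzs; have [k ltC] := op_lt_total b C.
have [s' [C' [As' nzs' _ eq0]]] := pseudo_division (@diffop_domain F)
  (ord_ops_subring F (~~ b)) (@ord_ops_skew F b) (@ord_ops_Ore F (~~ b))
  As nzs (erefl : poly_lt _ (dvar F b) 0 0) ltC.
by exists s', C'; split=> //; apply: subr0_eq; rewrite -[in RHS]eq0 mulr1 addr0.
Qed.

(** The saturation of I is a left ideal by the Ore condition, and it still
    avoids the nonzero ordinary operators. It is therefore non-holonomic, and
    maximality of I applies. *)
Lemma max_saturated b P I : P != 0 -> max_non_holonomic_overideal (principal P) I ->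
  ~ meets_ord I (~~ b) -> saturated b I.
Proof.
move=> nzP [[idI subI nhI] maxI] nmI s B As nzs IsB.
pose J : set D := [set Q | exists t, [/\ ord_ops (~~ b) t, t != 0 & I (t * Q)]].
have [A1 _ AM] := ord_ops_subring F (~~ b).
have IJ : I `<=` J by move=> Q IQ; exists 1; rewrite mul1r oner_neq0.
have idJ : left_ideal J.
  split; first exact: (IJ _ (ideal0 idI)).
  - move=> Q R [t [At nzt IQ]] [u [Au nzu IR]].
    have [e [f [Ae Af nze eqef]]] := ord_ops_Ore At Au nzu.
    exists (e * t); split; [exact: AM|exact: (mul_neq0 (@diffop_domain F))|].
    by rewrite mulrDr {2}eqef -!mulrA; apply: idealD => //; apply: idealM.
  move=> C Q [t [At nzt IQ]]; have [t' [C' [At' nzt' eqC]]] := ord_left_multiple C At nzt.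
  by exists t'; split=> //; rewrite mulrA eqC -mulrA; apply: idealM.
have JP : J P by apply: IJ; apply: subI; apply: principal_self.
have nmJ : ~ meets_ord J (~~ b).
  move=> [t [At nzt [u [Au nzu Iut]]]]; apply: nmI; exists (u * t).
  by split=> //; [exact: AM|exact: (mul_neq0 (@diffop_domain F))].
have eqJ : J = I.
  apply: maxI => //; split=> //; first exact: principal_sub.
  exact: (non_holonomic_disjoint idJ JP nzP nmJ).
by rewrite -eqJ; exists s.
Qed.

Lemma max_sub_eq P I J : max_non_holonomic_overideal (principal P) I ->
  max_non_holonomic_overideal (principal P) J -> I `<=` J -> I = J.
Proof. by move=> [_ maxI] [nhJ _] /(maxI _ nhJ). Qed.

Lemma max_member P I : max_non_holonomic_overideal (principal P) I -> I P.
Proof. by move=> [[_ sub _] _]; apply/sub/principal_self. Qed.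

Lemma max_ideal P I : max_non_holonomic_overideal (principal P) I -> left_ideal I.
Proof. by move=> [[]]. Qed.

(** The two ideals are a representative with the property T and one without
    it; where none exists, any set will do. *)
Lemma at_most_two_dichotomy (S : set (set D)) (T : set D -> Prop) :
  (forall I J, S I -> S J -> T I -> T J -> I = J) ->
  (forall I J, S I -> S J -> ~ T I -> ~ T J -> I = J) -> at_most_two S.
Proof.
move=> eqT eqnT.
have pick (U : set D -> Prop) : (forall I J, S I -> S J -> U I -> U J -> I = J) ->
    exists I0, forall I, S I -> U I -> I = I0.
  move=> eqU; have [[I0 [SI0 UI0]]|none] := pselect (exists I, S I /\ U I).
    by exists I0 => I SI UI; apply: eqU.
  by exists setT => I SI UI; case: none; exists I.
have [[I1 H1] [I2 H2]] := (pick T eqT, pick (fun I => ~ T I) eqnT).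
exists I1, I2 => I SI; have [TI|nTI] := pselect (T I).
  by left; apply: H1.
by right; apply: H2.
Qed.

Section Quotient.
Variables (P : D) (b : bool) (n : nat).
Hypotheses (nzP : P != 0) (leadP : unit_lead b n P).
Local Notation maxP := (max_non_holonomic_overideal (principal P)).

Lemma max_disjoint I : maxP I -> ~ meets_ord I (~~ b).
Proof.
move=> maxI; have [[idI _ nhI] _] := maxI.
exact: (unit_lead_disjoint idI (max_member maxI) leadP nhI).
Qed.

Lemma max_free I : maxP I -> free_below b 1 I.
Proof. by move=> /max_disjoint /disjoint_free. Qed.

Lemma max_sat I : maxP I -> saturated b I.
Proof. by move=> maxI; apply: (max_saturated nzP maxI (max_disjoint maxI)). Qed.

Lemma max_eq_of_common r I J Q : maxP I -> maxP J -> free_below b r I ->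
  op_lt b r.+1 Q -> Q != 0 -> I Q -> J Q -> I = J.
Proof.
move=> maxI maxJ freeI ltQ nzQ IQ JQ; apply: (max_sub_eq maxI maxJ).
exact: (sub_saturated (max_ideal maxI) (max_ideal maxJ) freeI (max_sat maxJ) ltQ nzQ).
Qed.

Lemma free_principal I : maxP I -> free_below b n I -> I = principal P.
Proof.
move=> maxI freeI; have IP := max_member maxI; have idI := max_ideal maxI.
apply/seteqP; split=> [B IB|]; last exact: principal_sub.
apply: contrapT => nB; have [Q [IQ nzQ ltQ]] := reduce_unit_lead idI IP leadP IB nB.
by case/eqP: nzQ; apply: freeI.
Qed.

Lemma inter_principal I J : maxP I -> maxP J -> free_below b n (I `&` J) ->
  principal P = I `&` J.
Proof.
move=> maxI maxJ freeIJ.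
have [idI idJ] := (max_ideal maxI, max_ideal maxJ).
have IJP : (I `&` J) P by split; apply: max_member.
apply/seteqP; split=> [|B IJB]; first exact: (principal_sub (setI_ideal idI idJ)).
apply: contrapT => nB; have [Q [IQ nzQ ltQ]] :=
  reduce_unit_lead (setI_ideal idI idJ) IJP leadP IJB nB.
by case/eqP: nzQ; apply: freeIJ.
Qed.

(** A common nonzero element of degree less than two would have the least
    possible degree in I, which would force I to be contained in J. *)
Lemma inter_free2 I J : maxP I -> maxP J -> I <> J -> free_below b 2 (I `&` J).
Proof.
move=> maxI maxJ neIJ Q ltQ [IQ JQ]; apply/eqP/negP => /negP nzQ.
by apply: neIJ; exact: (max_eq_of_common maxI maxJ (max_free maxI) ltQ nzQ IQ JQ).
Qed.

End Quotient.

(** Nonzero ordinary operators in the same derivation have a nonzero common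
    left multiple. *)
Lemma meets_ord_inter b I J : left_ideal I -> left_ideal J ->
  meets_ord I b -> meets_ord J b -> meets_ord (I `&` J) b.
Proof.
move=> idI idJ [s [As nzs Is]] [t [At nzt Jt]].
have [e [f [Ae Af nze eqef]]] := ord_ops_Ore As At nzt.
have [_ _ AM] := ord_ops_subring F b.
exists (e * s); split; [exact: AM|exact: (mul_neq0 (@diffop_domain F))|].
by split; [apply: idealM|rewrite eqef; apply: idealM].
Qed.

End Overideals.

(** * Operators with finitely many maximal overideals *)

Section Monomials.
Variable F : pdiffFieldType.
Local Notation D := (diffop F).
Local Notation poly2 := {mpoly F[2]}.

Definition mono (c : F) (i j : nat) : D := c *: (opx ^+ i * opy ^+ j).

Lemma monoE c i j : mono c i j = (c *: 'X_[monom2 i j] : poly2).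
Proof.
rewrite /mono; congr (_ *: _); rewrite -op_monomE.
by rewrite monom2x monom2y.
Qed.

Lemma mono_lt_x n c i j : (i < n)%N -> op_lt true n (mono c i j).
Proof.
move=> ltin; have sub := ord_ops_subring F (~~ true); have [_ _ AM] := sub.
apply: (poly_lt_leq sub ltin); rewrite /mono.
rewrite (commrX _ (commr_sym (commrX _ (commr_sym (@opxyC F))))).
rewrite scalerAl scale_constE; apply: (poly_lt_term _ sub).
apply: (AM); first exact: ord_ops_const.
elim: j => [|j IHj]; first by case: sub.
by rewrite exprS; apply: (AM) => //; apply: (ord_ops_dvar F false).
Qed.

Lemma mono_lt_y n c i j : (j < n)%N -> op_lt false n (mono c i j).
Proof.
move=> ltjn; have sub := ord_ops_subring F (~~ false); have [_ _ AM] := sub.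
apply: (poly_lt_leq sub ltjn); rewrite /mono scalerAl scale_constE.
apply: (poly_lt_term _ sub); apply: (AM); first exact: ord_ops_const.
elim: i => [|i IHi]; first by case: sub.
by rewrite exprS; apply: (AM) => //; apply: (ord_ops_dvar F true).
Qed.

Lemma op_ltD b n (P Q : D) : op_lt b n P -> op_lt b n Q -> op_lt b n (P + Q).
Proof. exact: (poly_ltD (ord_ops_subring F _)). Qed.

Lemma monom2_eq i j k l : (monom2 i j == monom2 k l) = (i == k) && (j == l).
Proof.
apply/eqP/andP => [eqm|[/eqP -> /eqP -> //]].
by rewrite -(monom2x i j) -{2}(monom2y i j) eqm monom2x monom2y !eqxx.
Qed.

Lemma eval_monom2 (pt : 'I_2 -> F) i j :
  ('X_[monom2 i j] : poly2).@[pt] = pt ix ^+ i * pt iy ^+ j.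
Proof.
rewrite mevalX !big_ord_recl big_ord0 mulr1.
have -> : lift ord0 ord0 = iy by apply/val_inj.
have -> : ord0 = ix by apply/val_inj.
by rewrite monom2x monom2y.
Qed.

Variables (w : 'I_2 -> nat).

Lemma graded_mono c i j : graded w (mono c i j) =
  (c *: 'X_[monom2 i j] : poly2) *: 'X^(i * w ix + j * w iy).
Proof.
rewrite monoE gradedZ gradedX scalerA mul_mpolyC; congr (_ *: 'X^_).
rewrite /weight !big_ord_recl big_ord0 addn0.
have -> : lift ord0 ord0 = iy by apply/val_inj.
have -> : ord0 = ix by apply/val_inj.
by rewrite monom2x monom2y mulnC [(w iy * _)%N]mulnC.
Qed.

Lemma graded_mono_low d c i j : (i * w ix + j * w iy < d)%N ->
  (size (graded w (mono c i j)) <= d)%N.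
Proof.
by move=> ltd; rewrite graded_mono (leq_trans (size_scale_leq _ _)) // size_polyXn.
Qed.

Lemma graded_addl_low d (P Q : D) : (size (graded w P) <= d)%N ->
  (size (graded w Q) <= d)%N -> (size (graded w (P + Q)) <= d)%N.
Proof.
by move=> szP szQ; rewrite gradedD (leq_trans (size_polyD _ _)) // geq_max szP.
Qed.

(** Two distinct monomials of the same weight cannot cancel, and the other
    terms have lower weight. *)
Lemma lead_form_two_terms d c i j c' i' j' (R P : D) :
  P = mono c i j + mono c' i' j' + R ->
  c != 0 -> ~~ ((i' == i) && (j' == j)) ->
  (i * w ix + j * w iy = d)%N -> (i' * w ix + j' * w iy = d)%N ->
  (size (graded w R) <= d)%N ->
  P != 0 /\ lead_form w P = c *: 'X_[monom2 i j] + c' *: 'X_[monom2 i' j'].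
Proof.
move=> -> nzc neq eqd eqd' szR.
set t := _ *: _ + _ *: _; have nzt : t != 0.
  apply: contraNneq nzc => t0; have : t@_(monom2 i j) = 0 by rewrite t0 mcoeff0.
  by rewrite /t mcoeffD !mcoeffZ !mcoeffX eqxx monom2_eq (negbTE neq) mulr1 mulr0 addr0 => ->.
suff lf : lead_form w (mono c i j + mono c' i' j' + R) = t.
  by rewrite -(lead_form_eq0 w) lf.
rewrite /lead_form !gradedD !graded_mono eqd eqd' -scalerDl lead_coefDl.
  by rewrite lead_coefZ lead_coefXn mulr1.
by rewrite size_scale // size_polyXn ltnS.
Qed.

Definition wts (a c : nat) (i : 'I_2) : nat := if i == ix then a else c.
Definition coords (v u : F) (i : 'I_2) : F := if i == ix then v else u.

End Monomials.

Section Cases.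
Variable F : pdiffFieldType.
Local Notation D := (diffop F).
Variables (P : D) (p0 p1 p2 p3 p4 p5 : F).
Local Notation maxP := (max_non_holonomic_overideal (principal P)).

(** The common conclusion of all the finite cases. *)
Definition at_most_two_complementary : Prop :=
  at_most_two maxP /\
  (forall I1 I2 : set D, maxP I1 -> maxP I2 -> I1 <> I2 -> principal P = I1 `&` I2).

Lemma at_most_two_of_unique : (forall I, maxP I -> I = principal P) ->
  at_most_two_complementary.
Proof.
move=> uniqP; split; first by exists (principal P), (principal P) => I /uniqP ->; left.
by move=> I1 I2 /uniqP -> /uniqP ->.
Qed.

Let wts_gt0 a c : (0 < a)%N -> (0 < c)%N -> forall i, (0 < wts a c i)%N.
Proof. by move=> a0 c0 i; rewrite /wts; case: ifP. Qed.

Let coords_neq0 (v u : F) : v != 0 -> u != 0 -> forall i, coords v u i != 0.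
Proof. by move=> v0 u0 i; rewrite /coords; case: ifP. Qed.

(** Since p0 is invertible, P is monic of degree two in d_x up to a factor,
    and distinct maximal overideals meet in <P>. They are told apart by
    whether they meet F[d_x]: two ideals that do would give a nonzero multiple
    of P in F[d_x], excluded by the leading form; and an ideal that does not
    has P as an element of least d_y-degree, because a factor of d_y-degree
    one is excluded by the Newton polygon. *)
Lemma case_double_simple :
  P = opy ^+ 2 * opx + p0 *: opx ^+ 2 + p1 *: opy ^+ 2 + p2 *: (opx * opy)
       + p3 *: opy + p4 *: opx + p5%:A ->
  p0 != 0 -> at_most_two_complementary.
Proof.
move=> defP nzp0.
have {}defP : P = mono 1 1 2 + mono p0 2 0 + (mono p1 0 2 + mono p2 1 1
    + mono p3 0 1 + mono p4 1 0 + mono p5 0 0).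
  rewrite defP /mono !expr0 !expr1 !mulr1 !mul1r scale1r !addrA.
  by rewrite (commrX 2 (@opxyC F)).
have leadP : unit_lead true 2 P.
  exists p0, (mono 1 1 2 + (mono p1 0 2 + mono p2 1 1
    + mono p3 0 1 + mono p4 1 0 + mono p5 0 0)); split=> //.
    do ?[apply: op_ltD]; apply: mono_lt_x => //.
  have -> : p0%:A * dvar F true ^+ 2 = mono p0 2 0 by rewrite mulr_algl /mono mulr1.
  by rewrite defP [RHS]addrA; congr (_ + _); apply: addrC.
(* The leading form is v (w^2 + p0 v), which vanishes at (-1/p0, 1). *)
pose w := wts 2 1; pose pt := coords (- p0^-1) 1.
have w0 := wts_gt0 (isT : 0 < 2)%N (isT : 0 < 1)%N.
have pt0 : forall i, pt i != 0.
  by apply: coords_neq0; rewrite ?oner_neq0 // oppr_eq0 invr_eq0.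
have [|||||nzP lfP] := @lead_form_two_terms _ w 4 1 1 2 p0 2 0 _ P defP;
  rewrite ?oner_neq0 //.
  by do !(apply: graded_addl_low => //); apply: graded_mono_low.
have evP : (lead_form w P).@[pt] = 0.
  rewrite lfP mevalD !mevalZ !eval_monom2 /pt /coords /=.
  by field.
have ltyP : op_lt false 3 P.
  rewrite defP.
  by do ?[apply: op_ltD]; apply: mono_lt_y.
have interP I J : maxP I -> maxP J -> I <> J -> principal P = I `&` J.
  move=> maxI maxJ neIJ; apply: (inter_principal leadP maxI maxJ).
  exact: (inter_free2 nzP leadP maxI maxJ neIJ).
split=> //; apply: (@at_most_two_dichotomy _ _ (fun I => meets_ord I true)).
  (* A common element in F[d_x] would be a multiple of P. *)
  move=> I J maxI maxJ mI mJ; apply: contrapT => neIJ.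
  have [s [As nzs]] := meets_ord_inter (max_ideal maxI) (max_ideal maxJ) mI mJ.
  rewrite -(interP I J) // => -[C _ eqs].
  exact: (newton_no_ord w0 (pt0 _) evP As nzs (esym eqs)).
(* The roles of d_x and d_y are exchanged: P has d_y-degree two. *)
move=> I J maxI maxJ nmI nmJ.
have [idI idJ] := (max_ideal maxI, max_ideal maxJ).
have [IP JP] := (max_member maxI, max_member maxJ).
have satJ : saturated false J := @max_saturated F false P J nzP maxJ nmJ.
have freeI : free_below false 1 I := @disjoint_free F I false nmI.
have freeI2 : free_below false 2 I.
  move=> L ltL IL; apply/eqP/negP => /negP nzL.
  have [s [C [As nzs ltC eqC]]] :=
    minimal_division idI freeI ltL nzL IL (ltyP : op_lt false (1 + 2) P) IP.
  have := newton_factor w0 pt0 (isT : ~~ odd (w (var_index (~~ false)))) isT nzP nzs ltC eqC.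
  rewrite evP eqxx => /(_ _)/negP; apply=> //.
  exact: (eval_lead_lt2 w0 pt0 _ _ ltL nzL).
exact: (max_sub_eq maxI maxJ (sub_saturated idI idJ freeI2 satJ ltyP nzP IP JP)).
Qed.

Let triple_form := opy ^+ 3 + p0 *: opx ^+ 2 + p1 *: opy ^+ 2
  + p2 *: (opx * opy) + p3 *: opy + p4 *: opx + p5%:A.

Let triple_formE : triple_form = mono 1 0 3 + mono p0 2 0 + (mono p1 0 2
    + mono p2 1 1 + mono p3 0 1 + mono p4 1 0 + mono p5 0 0).
Proof.
by rewrite /triple_form /mono !expr0 !expr1 !mulr1 !mul1r scale1r !addrA.
Qed.

(** P has degree two in d_x with invertible leading coefficient. A maximal
    overideal other than <P> would contain an element of d_x-degree one, hence
    give a factorization of P into two factors of degree one, excluded by the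
    Newton polygon with slope 3/2. *)
Lemma case_triple_p0 : P = triple_form -> p0 != 0 -> at_most_two_complementary.
Proof.
rewrite triple_formE => defP nzp0; apply: at_most_two_of_unique => I maxI.
have leadP : unit_lead true 2 P.
  exists p0, (mono 1 0 3 + (mono p1 0 2 + mono p2 1 1
    + mono p3 0 1 + mono p4 1 0 + mono p5 0 0)); split=> //.
    by do ?[apply: op_ltD]; apply: mono_lt_x.
  have -> : p0%:A * dvar F true ^+ 2 = mono p0 2 0 by rewrite mulr_algl /mono mulr1.
  by rewrite defP [RHS]addrA; congr (_ + _); apply: addrC.
(* The leading form is w^3 + p0 v^2, which vanishes at (p0, -p0). *)
pose w := wts 3 2; pose pt := coords p0 (- p0).
have w0 := wts_gt0 (isT : 0 < 3)%N (isT : 0 < 2)%N.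
have pt0 : forall i, pt i != 0 by apply: coords_neq0; rewrite ?oppr_eq0.
have [|||||nzP lfP] := @lead_form_two_terms _ w 6 1 0 3 p0 2 0 _ P defP;
  rewrite ?oner_neq0 //.
  by do !(apply: graded_addl_low => //); apply: graded_mono_low.
have evP : (lead_form w P).@[pt] = 0.
  rewrite lfP mevalD !mevalZ !eval_monom2 /pt /coords /=.
  by ring.
have idI := max_ideal maxI; have IP := max_member maxI.
have freeI : free_below true 1 I := max_free leadP maxI.
apply: (free_principal leadP maxI) => L ltL IL; apply/eqP/negP => /negP nzL.
have [s [C [As nzs ltC eqC]]] := minimal_division idI freeI ltL nzL IL
  (unit_lead_lt leadP : op_lt true (1 + 2) P) IP.
have := newton_factor w0 pt0 (isT : ~~ odd (w (var_index (~~ true)))) isT nzP nzs ltC eqC.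
rewrite evP eqxx => /(_ _)/negP; apply=> //.
exact: (eval_lead_lt2 w0 pt0 _ _ ltL nzL).
Qed.

Let lead_triple_y : P = triple_form -> p0 = 0 -> unit_lead false 3 P.
Proof.
rewrite triple_formE => defP p00; exists 1, (mono p1 0 2
    + mono p2 1 1 + mono p3 0 1 + mono p4 1 0 + mono p5 0 0); split.
- exact: oner_neq0.
- by do ?[apply: op_ltD]; apply: mono_lt_y.
have -> : 1%:A * dvar F false ^+ 3 = mono 1 0 3 by rewrite mulr_algl /mono mul1r.
by rewrite defP p00 [mono 0 2 0]scale0r addr0.
Qed.

(** P is monic of degree three in d_y. The intersection of two distinct
    maximal overideals has no element of d_y-degree less than two; an element
    B of d_y-degree two would divide P with a cofactor of degree one, and
    would itself split into factors of degree one, excluded by the Newton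
    polygon. The ideals are told apart by whether they meet F[d_y]. *)
Lemma case_triple_p2 : P = triple_form -> p0 = 0 -> p2 != 0 ->
  at_most_two_complementary.
Proof.
move=> formP p00 nzp2; have leadP := lead_triple_y formP p00.
have defP : P = mono 1 0 3 + mono p2 1 1 +
   (mono p1 0 2 + mono p3 0 1 + mono p4 1 0 + mono p5 0 0).
  rewrite formP triple_formE p00 [mono 0 2 0]scale0r addr0 !addrA.
  by rewrite [in RHS](addrAC _ (mono p2 1 1)).
(* The leading form is w (w^2 + p2 v), which vanishes at (-1/p2, 1). *)
pose w := wts 2 1; pose pt := coords (- p2^-1) 1.
have w0 := wts_gt0 (isT : 0 < 2)%N (isT : 0 < 1)%N.
have pt0 : forall i, pt i != 0.
  by apply: coords_neq0; rewrite ?oner_neq0 // oppr_eq0 invr_eq0.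
have [|||||nzP lfP] := @lead_form_two_terms _ w 3 1 0 3 p2 1 1 _ P defP;
  rewrite ?oner_neq0 //.
  by do !(apply: graded_addl_low => //); apply: graded_mono_low.
have evP : (lead_form w P).@[pt] = 0.
  rewrite lfP mevalD !mevalZ !eval_monom2 /pt /coords /=.
  by field.
have ltxP : op_lt true 2 P.
  by rewrite defP; do ?[apply: op_ltD]; apply: mono_lt_x.
have evenx : ~~ odd (w (var_index (~~ false))) by [].
have interP I J : maxP I -> maxP J -> I <> J -> principal P = I `&` J.
  move=> maxI maxJ neIJ; apply: (inter_principal leadP maxI maxJ) => B ltB [IB JB].
  have [idI idJ] := (max_ideal maxI, max_ideal maxJ).
  have [IP JP] := (max_member maxI, max_member maxJ).
  apply/eqP/negP => /negP nzB; apply: neIJ.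
  have [freeI2|nfreeI2] := pselect (free_below false 2 I).
    exact: (max_eq_of_common nzP leadP maxI maxJ freeI2 ltB nzB IB JB).
  apply: contrapT => neIJ; case: nfreeI2 => L ltL IL; apply/eqP/negP => /negP nzL.
  have freeI := max_free leadP maxI.
  have [s [C [As nzs ltC eqC]]] :=
    minimal_division idI freeI ltL nzL IL (ltB : op_lt false (1 + 2) B) IB.
  (* s B = C L with L and C of degree one: B inherits a monomial leading form. *)
  have evB := newton_factor w0 pt0 evenx isT nzB nzs ltC eqC
    (eval_lead_lt2 w0 pt0 evenx isT ltL nzL).
  have freeIJ := inter_free2 nzP leadP maxI maxJ neIJ.
  have [t [E [At nzt ltE eqE]]] := minimal_division (setI_ideal idI idJ) freeIJ ltB nzB
    (conj IB JB) (unit_lead_lt leadP : op_lt false (2 + 2) P) (conj IP JP).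
  have := newton_factor w0 pt0 evenx isT nzP nzt ltE eqE evB.
  by rewrite evP eqxx.
split=> //; apply: (@at_most_two_dichotomy _ _ (fun I => meets_ord I false)).
  (* A common element in F[d_y] would be a multiple of P. *)
  move=> I J maxI maxJ mI mJ; apply: contrapT => neIJ.
  have [s [As nzs]] := meets_ord_inter (max_ideal maxI) (max_ideal maxJ) mI mJ.
  rewrite -(interP I J) // => -[C _ eqs].
  exact: (newton_no_ord w0 (pt0 _) evP As nzs (esym eqs)).
(* The roles of d_x and d_y are exchanged: P has d_x-degree one. *)
move=> I J maxI maxJ nmI nmJ.
have satJ : saturated true J := @max_saturated F true P J nzP maxJ nmJ.
have freeI : free_below true 1 I := @disjoint_free F I true nmI.
exact: (max_sub_eq maxI maxJ (sub_saturated (max_ideal maxI) (max_ideal maxJ) freeI satJ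
  ltxP nzP (max_member maxI) (max_member maxJ))).
Qed.

(** P has degree one in d_x with invertible leading coefficient, and a maximal
    overideal has no nonzero element of d_x-degree zero. *)
Lemma case_triple_p4 : P = triple_form -> p0 = 0 -> p2 = 0 -> p4 != 0 ->
  at_most_two_complementary.
Proof.
move=> formP p00 p20 nzp4; apply: at_most_two_of_unique => I maxI.
have leadP : unit_lead true 1 P.
  exists p4, (mono 1 0 3 + mono p1 0 2 + mono p3 0 1 + mono p5 0 0); split=> //.
    by do ?[apply: op_ltD]; apply: mono_lt_x.
  have -> : p4%:A * dvar F true ^+ 1 = mono p4 1 0 by rewrite mulr_algl /mono mulr1.
  rewrite formP triple_formE p00 p20 [mono 0 2 0]scale0r [mono 0 1 1]scale0r !addr0 !addrA.
  by rewrite [LHS](ACl (4*1*2*3*5)%AC).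
exact: (free_principal leadP maxI (max_free leadP maxI)).
Qed.
End Cases.

(** * Formal power series *)

Definition pseries (F : fieldType) : Type := nat -> F.

Section PowerSeries.
Variable F : fieldType.
Local Notation R := (pseries F).
Implicit Types f g h : R.

HB.instance Definition _ := gen_eqMixin R.
HB.instance Definition _ := gen_choiceMixin R.

Definition ps_zero : R := fun=> 0.
Definition ps_opp f : R := fun n => - f n.
Definition ps_add f g : R := fun n => f n + g n.

Lemma ps_addA : associative ps_add.
Proof. by move=> f g h; apply/funext => n; apply: addrA. Qed.
Lemma ps_addC : commutative ps_add.
Proof. by move=> f g; apply/funext => n; apply: addrC. Qed.
Lemma ps_add0 : left_id ps_zero ps_add.
Proof. by move=> f; apply/funext => n; apply: add0r. Qed.
Lemma ps_addN : left_inverse ps_zero ps_opp ps_add.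
Proof. by move=> f; apply/funext => n; apply: addNr. Qed.

HB.instance Definition _ := GRing.isZmodule.Build R ps_addA ps_addC ps_add0 ps_addN.

Lemma ps_addE f g n : (f + g) n = f n + g n.
Proof. by []. Qed.

Definition ps_const (c : F) : R := fun n => if n is 0%N then c else 0.
Definition ps_mul f g : R := fun n => \sum_(i < n.+1) f i * g (n - i)%N.

(** The coefficients of a product up to degree n only depend on the
    truncations, so that the ring identities are inherited from
    polynomials. *)
Definition ps_trunc n f : {poly F} := \poly_(i < n.+1) f i.

Lemma coef_trunc n f i : (i <= n)%N -> (ps_trunc n f)`_i = f i.
Proof. by move=> lein; rewrite coef_poly ltnS lein. Qed.

Lemma ps_mulE N f g n : (n <= N)%N -> ps_mul f g n = (ps_trunc N f * ps_trunc N g)`_n.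
Proof.
move=> lenN; rewrite coefM; apply: eq_bigr => i _.
have lein : (i <= n)%N by rewrite -ltnS.
by rewrite !coef_trunc ?(leq_trans (leq_subr _ _)) // (leq_trans lein).
Qed.

Lemma ps_mulC : commutative ps_mul.
Proof. by move=> f g; apply/funext => n; rewrite !(@ps_mulE n) // mulrC. Qed.

Lemma ps_mulA : associative ps_mul.
Proof.
move=> f g h; apply/funext => n.
have trunc_mul f' g' i : (i <= n)%N ->
    (ps_trunc n (ps_mul f' g'))`_i = (ps_trunc n f' * ps_trunc n g')`_i.
  by move=> lein; rewrite coef_trunc // (@ps_mulE n).
rewrite !(@ps_mulE n) //; transitivity ((ps_trunc n f * (ps_trunc n g * ps_trunc n h))`_n).
  by rewrite !coefM; apply: eq_bigr => i _; rewrite trunc_mul // leq_subr.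
rewrite mulrA !(coefM _ (ps_trunc n h)); apply: eq_bigr => i _.
by rewrite trunc_mul // -ltnS.
Qed.

Lemma ps_mul1 : left_id (ps_const 1) ps_mul.
Proof.
move=> f; apply/funext => n; rewrite /ps_mul big_ord_recl mul1r subn0.
by rewrite big1 ?addr0 // => i _; rewrite mul0r.
Qed.

Lemma ps_mulDl : left_distributive ps_mul +%R.
Proof.
move=> f g h; apply/funext => n; rewrite [RHS]ps_addE /ps_mul -big_split.
by apply: eq_bigr => i _; apply: mulrDl.
Qed.

Lemma ps_one_neq0 : ps_const 1 != 0 :> R.
Proof. by apply/eqP => /(congr1 (@^~ 0%N)) /eqP; rewrite oner_eq0. Qed.

HB.instance Definition _ := GRing.Zmodule_isComNzRing.Build R
  ps_mulA ps_mulC ps_mul1 ps_mulDl ps_one_neq0.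

(** The inverse is obtained by choice, the units being those elements that
    have one. *)
Definition ps_unit : {pred R} := fun f => `[< exists g, g * f = 1 >].
Definition ps_inv f : R :=
  if pselect (exists g, g * f = 1) is left ex then sval (cid ex) else f.

Lemma ps_mulV : {in ps_unit, left_inverse 1 ps_inv *%R}.
Proof.
move=> f /asboolP ex; rewrite /ps_inv; case: pselect => // ex'.
by case: cid.
Qed.

Lemma ps_unitP f g : g * f = 1 -> ps_unit f.
Proof. by move=> gf1; apply/asboolP; exists g. Qed.

Lemma ps_inv_out : {in [predC ps_unit], ps_inv =1 id}.
Proof.
by move=> f /asboolP nex; rewrite /ps_inv; case: pselect.
Qed.

HB.instance Definition _ :=
  GRing.ComNzRing_hasMulInverse.Build R ps_mulV ps_unitP ps_inv_out.

Lemma ps_order f : f != 0 -> exists2 n, f n != 0 & forall i, (i < n)%N -> f i = 0.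
Proof.
move=> nzf; have ex : exists n, f n != 0.
  apply: contrapT => nex; case/eqP: nzf; apply/funext => n; apply/eqP.
  by apply/negPn/negP => nz; apply: nex; exists n.
case: (ex_minnP ex) => n nzn minn; exists n => // i ltin.
by apply/eqP/negPn/negP => /minn; rewrite leqNgt ltin.
Qed.

(** The product of the terms of lowest degree does not vanish. *)
Lemma ps_integral f g : f * g = 0 -> (f == 0) || (g == 0).
Proof.
move=> fg0; apply/negPn/negP; rewrite negb_or => /andP[/ps_order[n nzn zf] /ps_order[k nzk zg]].
have : (f * g) (n + k)%N = 0 by rewrite fg0.
have ltn : (n < (n + k).+1)%N by rewrite ltnS leq_addr.
have -> : (f * g) (n + k)%N = f n * g k.
  rewrite /GRing.mul /= /ps_mul (bigD1 (Ordinal ltn)) //= addKn big1 ?addr0 // => i.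
  rewrite -val_eqE /= => nein; case: (ltngtP i n) nein => // lt _.
    by rewrite zf ?mul0r.
  by rewrite [g _]zg ?mulr0 //; have := ltn_ord i; lia.
by move/eqP; rewrite mulf_eq0 (negbTE nzn) (negbTE nzk).
Qed.

HB.instance Definition _ := GRing.ComUnitRing_isIntegral.Build R ps_integral.

Lemma ps_const_zmod : zmod_morphism ps_const.
Proof. by move=> a b; apply/funext => -[|n] //; apply/esym/subr0. Qed.

HB.instance Definition _ := GRing.isZmodMorphism.Build F R ps_const ps_const_zmod.

Lemma ps_constM c f : ps_const c * f = (fun n => c * f n) :> R.
Proof.
apply/funext => n; rewrite /GRing.mul /= /ps_mul big_ord_recl /= subn0.
by rewrite big1 ?addr0 // => i _; rewrite mul0r.
Qed.

Lemma ps_const_monoid : monoid_morphism ps_const.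
Proof.
split=> // a b; rewrite ps_constM; apply/funext => -[|n] //=.
by rewrite mulr0.
Qed.

HB.instance Definition _ := GRing.isMonoidMorphism.Build F R ps_const ps_const_monoid.

End PowerSeries.

(** * Derivations on power series and on fraction fields *)

Definition is_derivation (R : nzRingType) (d : R -> R) : Prop :=
  (forall a b, d (a + b) = d a + d b) /\ (forall a b, d (a * b) = d a * b + a * d b).

Lemma derivation1 (R : nzRingType) (d : R -> R) : is_derivation d -> d 1 = 0.
Proof.
move=> [_ dM]; have := dM 1 1; rewrite mulr1 mul1r => /eqP.
by rewrite mulr1 -subr_eq0 opprD addNKr oppr_eq0 => /eqP.
Qed.

Lemma derivation_add (R : nzRingType) (d1 d2 : R -> R) :
  is_derivation d1 -> is_derivation d2 -> is_derivation (fun a => d1 a + d2 a).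
Proof.
move=> [d1D d1M] [d2D d2M]; split=> a b; first by rewrite d1D d2D addrACA.
by rewrite d1M d2M mulrDl mulrDr addrACA.
Qed.

Section FractionDerivation.
Variable R : idomainType.
Local Notation K := {fraction R}.
Local Notation "a %:F" := (@FracField.tofrac R a).

Lemma fraction_numden (x : K) : exists a b, b != 0 /\ x = a%:F / b%:F.
Proof.
elim/quotW: x => y; exists (frac y).1, (frac y).2; split; first exact: denom_ratioP.
rewrite -[in LHS](Ratio_numden y); unlock FracField.tofrac.
rewrite -[X in _ = _ * X]FracField.pi_inv -[RHS]FracField.pi_mul.
rewrite /FracField.mulf /FracField.invf.
by rewrite !numden_Ratio ?denom_ratioP ?oner_neq0 // ?mulr1 ?mul1r // denom_ratioP.
Qed.

(** The quotient rule, applied to a chosen representation of x as a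
    fraction. *)
Definition frac_der (d : R -> R) (x : K) : K :=
  let a := xget (0, 1) [set p | p.2 != 0 /\ x = p.1%:F / p.2%:F]%classic in
  (d a.1 * a.2 - a.1 * d a.2)%:F / (a.2 ^+ 2)%:F.

(** Independence of the representation: from n b = a m the Leibniz rule gives
    an identity between the derivatives, of which the claim is a
    combination. *)
Lemma frac_derE d a b : is_derivation d -> b != 0 ->
  frac_der d (a%:F / b%:F) = (d a * b - a * d b)%:F / (b ^+ 2)%:F.
Proof.
move=> [dD dM] nzb; rewrite /frac_der; case: xgetP => [[n m] _ /= [nzm eqab]|]; last first.
  by move=> /(_ (a, b)) /=; case.
have nF (c : R) : c != 0 -> c%:F != 0 by rewrite tofrac_eq0.
have eqc : n * b = a * m.
  apply/eqP; rewrite -tofrac_eq !tofracM; apply/eqP.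
  move: eqab => /eqP; by rewrite eqr_div ?nF // => /eqP ->.
have eqd : d n * b + n * d b = d a * m + a * d m by rewrite -!dM eqc.
apply/eqP; rewrite eqr_div ?nF ?expf_neq0 // -!tofracM tofrac_eq; apply/eqP.
rewrite !expr2; apply/subr0_eq.
have -> : (d n * m - n * d m) * (b * b) - (d a * b - a * d b) * (m * m) =
  (d n * b + n * d b - (d a * m + a * d m)) * (m * b)
  - (n * b - a * m) * (d b * m + d m * b) by ring.
by rewrite eqd eqc !subrr !mul0r subrr.
Qed.

Lemma frac_der_embed d a : is_derivation d -> frac_der d a%:F = (d a)%:F.
Proof.
move=> der; have := @frac_derE d a 1 der (oner_neq0 _).
by rewrite tofrac1 divr1 (derivation1 der) mulr0 subr0 mulr1 expr1n tofrac1 divr1.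
Qed.

Lemma frac_der_derivation d : is_derivation d -> is_derivation (frac_der d).
Proof.
move=> der; have [dD dM] := der.
have nF (c : R) : c != 0 -> c%:F != 0 by rewrite tofrac_eq0.
split=> x y; have [a [b [nzb ->]]] := fraction_numden x;
  have [c [e [nze ->]]] := fraction_numden y.
  rewrite addf_div ?nF // -!tofracM -tofracD !frac_derE ?mulf_neq0 // dD !dM.
  rewrite addf_div ?nF ?expf_neq0 // -!tofracM -tofracD.
  apply/eqP; rewrite eqr_div ?nF ?mulf_neq0 ?expf_neq0 ?mulf_neq0 //.
  by rewrite -!tofracM tofrac_eq; apply/eqP; ring.
rewrite mulf_div -!tofracM !frac_derE ?mulf_neq0 // !dM.
rewrite !mulf_div -!tofracM addf_div ?nF ?mulf_neq0 ?expf_neq0 // -!tofracM -tofracD.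
apply/eqP; rewrite eqr_div ?nF ?mulf_neq0 ?expf_neq0 ?mulf_neq0 //.
by rewrite -!tofracM tofrac_eq; apply/eqP; ring.
Qed.

Lemma frac_derC d1 d2 : is_derivation d1 -> is_derivation d2 ->
  (forall a, d1 (d2 a) = d2 (d1 a)) ->
  forall x, frac_der d1 (frac_der d2 x) = frac_der d2 (frac_der d1 x).
Proof.
move=> der1 der2 C12 x; have [[d1D d1M] [d2D d2M]] := (der1, der2).
have nF (c : R) : c != 0 -> c%:F != 0 by rewrite tofrac_eq0.
have [a [b [nzb ->]]] := fraction_numden x.
have dN (d : R -> R) : is_derivation d -> forall u v, d (u - v) = d u - d v.
  by move=> [dD _] u v; apply: (addIr (d v)); rewrite -dD !subrK.
rewrite !frac_derE ?expf_neq0 // !expr2 !(dN d1) // !(dN d2) // !d1M !d2M !C12.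
apply/eqP; rewrite eqr_div ?nF ?mulf_neq0 //.
by rewrite -!tofracM tofrac_eq; apply/eqP; ring.
Qed.

End FractionDerivation.

Section SeriesDerivations.
Variable F : fieldType.
Local Notation R := (pseries F).
Implicit Types f g : R.

Definition ps_map (d : F -> F) f : R := fun n => d (f n).
Definition ps_der f : R := fun n => f n.+1 *+ n.+1.

Lemma ps_map_derivation d : is_derivation d -> is_derivation (ps_map d).
Proof.
move=> [dD dM]; split=> f g; apply/funext => n; first exact: dD.
have d0 : d 0 = 0 by apply: (addIr (d 0)); rewrite -dD !add0r.
rewrite /ps_map ps_addE /GRing.mul /= /ps_mul -big_split /=.
by rewrite (big_morph d dD d0); apply: eq_bigr => i _; apply: dM.
Qed.

Lemma ps_der_derivation : is_derivation ps_der.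
Proof.
split=> f g; apply/funext => n; first by rewrite /ps_der ps_addE mulrnDl.
have truncS h i : (i <= n)%N -> ((ps_trunc n.+1 h)^`())`_i = (ps_trunc n (ps_der h))`_i.
  by move=> lein; rewrite coef_deriv !coef_trunc.
have trunc h i : (i <= n)%N -> (ps_trunc n.+1 h)`_i = (ps_trunc n h)`_i.
  by move=> lein; rewrite !coef_trunc // leqW.
have mulE h h' k N : (k <= N)%N -> (h * h' : R) k = (ps_trunc N h * ps_trunc N h')`_k.
  exact: ps_mulE.
rewrite ps_addE {1}/ps_der (mulE _ _ _ n.+1) // -coef_deriv derivM coefD.
rewrite (mulE (ps_der f) g n n) // (mulE f (ps_der g) n n) // !coefM.
congr (_ + _); apply: eq_bigr => i _; have lein : (i <= n)%N by rewrite -ltnS.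
  by rewrite truncS // trunc ?leq_subr.
by rewrite truncS ?leq_subr // trunc.
Qed.

End SeriesDerivations.

(** * Solving linear ordinary differential equations *)

(** A field extension of F in which linear differential equations in d_y have
    solutions with arbitrary initial values. *)
Definition laurent_field (F : fieldType) : Type := {fraction (pseries F)}.
HB.instance Definition _ (F : fieldType) := GRing.Field.on (laurent_field F).

Section LaurentField.
Variable F : pdiffFieldType.
Local Notation R := (pseries F).
Local Notation K := (laurent_field F).
Local Notation "a %:F" := (@FracField.tofrac R a).

Definition ps_dx : R -> R := ps_map (@derx F).
(** F consists of constants for d/dt, so F is a differential subfield, while
    each equation in d_y becomes a recursion for the coefficients of t^n. *)
Definition ps_dy (f : R) : R := ps_map (@dery F) f + ps_der f.

Lemma ps_dx_der : is_derivation ps_dx.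
Proof. by apply: ps_map_derivation; split; [exact: derxD|exact: derxM]. Qed.

Lemma ps_dy_der : is_derivation ps_dy.
Proof.
apply: derivation_add (ps_der_derivation F).
by apply: ps_map_derivation; split; [exact: deryD|exact: deryM].
Qed.

Lemma ps_dxyC f : ps_dx (ps_dy f) = ps_dy (ps_dx f).
Proof.
apply/funext => n; rewrite /ps_dx /ps_dy ps_addE /ps_map ps_addE /ps_der.
by rewrite derxD derxyC (raddfMn (@derx F)).
Qed.

HB.instance Definition _ := Field_isPdiff.Build K
  (proj1 (frac_der_derivation ps_dx_der)) (proj1 (frac_der_derivation ps_dy_der))
  (proj2 (frac_der_derivation ps_dx_der)) (proj2 (frac_der_derivation ps_dy_der))
  (frac_derC ps_dx_der ps_dy_der ps_dxyC).

Definition laurent_const : F -> K := fun c => (ps_const c)%:F.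

Lemma laurent_const_zmod : zmod_morphism laurent_const.
Proof. by move=> a b; rewrite /laurent_const (raddfB (@ps_const F)) (tofracB (R := R)). Qed.

HB.instance Definition _ := GRing.isZmodMorphism.Build F K laurent_const laurent_const_zmod.

Lemma laurent_const_monoid : monoid_morphism laurent_const.
Proof.
split; first by rewrite /laurent_const (rmorph1 (@ps_const F)) (tofrac1 R).
by move=> a b; rewrite /laurent_const (rmorphM (@ps_const F)) (tofracM (R := R)).
Qed.

HB.instance Definition _ := GRing.isMonoidMorphism.Build F K laurent_const laurent_const_monoid.

Lemma laurent_derx f : derx (f%:F : K) = (ps_dx f)%:F.
Proof. exact: (frac_der_embed f ps_dx_der). Qed.

Lemma laurent_dery f : dery (f%:F : K) = (ps_dy f)%:F.
Proof. exact: (frac_der_embed f ps_dy_der). Qed.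

Lemma laurent_const_derx a : laurent_const (derx a) = derx (laurent_const a).
Proof.
rewrite [RHS]laurent_derx; congr (_ %:F); apply/funext => -[|n] //=.
by rewrite /ps_dx /ps_map /= raddf0.
Qed.

Lemma laurent_const_dery a : laurent_const (dery a) = dery (laurent_const a).
Proof.
rewrite [RHS]laurent_dery; congr (_ %:F); apply/funext => n.
rewrite /ps_dy ps_addE /ps_map /ps_der /= mul0rn addr0.
by case: n => //=; rewrite raddf0.
Qed.

Hypothesis char0 : [pchar F] =i pred0.
Variables (p1 p3 p5 : F).

(** Coefficients of t^n in u, u' and u'' for the solution u with initial
    values 1, c, 0. *)
Fixpoint ode_coef (c : F) (n : nat) : F * F * F :=
  if n is k.+1 then
    let: (u, u1, u2) := ode_coef c k in
    ((u1 - dery u) / k.+1%:R, (u2 - dery u1) / k.+1%:R,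
     (- (p1 * u2 + p3 * u1 + p5 * u) - dery u2) / k.+1%:R)
  else (1, c, 0).

Definition ode_sol c : R := fun n => (ode_coef c n).1.1.
Definition ode_sol1 c : R := fun n => (ode_coef c n).1.2.
Definition ode_sol2 c : R := fun n => (ode_coef c n).2.

Let divK (x : F) n : x / n.+1%:R *+ n.+1 = x.
Proof. by rewrite -[LHS]mulr_natr divfK // (pcharf0P F).1. Qed.

Lemma ode_solS c n :
  [/\ ode_sol c n.+1 = (ode_sol1 c n - dery (ode_sol c n)) / n.+1%:R,
      ode_sol1 c n.+1 = (ode_sol2 c n - dery (ode_sol1 c n)) / n.+1%:R
    & ode_sol2 c n.+1 = (- (p1 * ode_sol2 c n + p3 * ode_sol1 c n + p5 * ode_sol c n)
        - dery (ode_sol2 c n)) / n.+1%:R].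
Proof.
by rewrite /ode_sol /ode_sol1 /ode_sol2 /=; case: (ode_coef c n) => [[u u1] u2].
Qed.

Lemma ode_sol_dy c : ps_dy (ode_sol c) = ode_sol1 c.
Proof.
apply/funext => n; rewrite /ps_dy ps_addE /ps_map /ps_der.
by have [-> _ _] := ode_solS c n; rewrite divK addrC subrK.
Qed.

Lemma ode_sol1_dy c : ps_dy (ode_sol1 c) = ode_sol2 c.
Proof.
apply/funext => n; rewrite /ps_dy ps_addE /ps_map /ps_der.
by have [_ -> _] := ode_solS c n; rewrite divK addrC subrK.
Qed.

Lemma ode_sol2_dy c : ps_dy (ode_sol2 c) + ps_const p1 * ode_sol2 c
  + ps_const p3 * ode_sol1 c + ps_const p5 * ode_sol c = 0.
Proof.
apply/funext => n; rewrite /ps_dy !ps_addE !ps_constM /ps_map /ps_der.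
have [_ _ ->] := ode_solS c n; rewrite divK.
rewrite [dery _ + _]addrC subrK -!addrA addNr.
by [].
Qed.

Definition ode_dpoly (k : nat) : dpoly F :=
  DAdd (DAdd (DAdd (DVar F k 0 3) (DMul (DConst p1) (DVar F k 0 2)))
    (DMul (DConst p3) (DVar F k 0 1))) (DMul (DConst p5) (DVar F k 0 0)).

(** The diagonal entries express that the solutions do not vanish, so that a
    single family of inequations indexed by pairs suffices. *)
Definition wronskian_dpoly (i j : nat) : dpoly F :=
  if i == j then DVar F i 0 0 else
  DAdd (DMul (DVar F i 0 0) (DVar F j 0 1))
    (DMul (DConst (-1)) (DMul (DVar F j 0 0) (DVar F i 0 1))).

(** In the fraction field of F[[t]] take the solutions with initial values 1,
    i, 0. The constant terms of their Wronskians are the differences j - i,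
    nonzero in characteristic zero. Differential closedness transfers the
    solvability of the system to F. *)
Lemma ode_solutions N : differentially_closed F -> exists e : nat -> F,
  (forall i, (i < N)%N -> dery (dery (dery (e i))) + p1 * dery (dery (e i))
      + p3 * dery (e i) + p5 * e i = 0 /\ e i != 0) /\
  (forall i j, (i < N)%N -> (j < N)%N -> i != j ->
     e i * dery (e j) - e j * dery (e i) != 0).
Proof.
move=> Fclosed; pose eqs (i : 'I_N) := ode_dpoly i.
pose ineqs (k : 'I_#|{: 'I_N * 'I_N}|) :=
  wronskian_dpoly (enum_val k).1 (enum_val k).2.
have [|e [He1 He2]] := Fclosed K laurent_const laurent_const_derx laurent_const_dery _ _ eqs ineqs.
  exists (fun i => (ode_sol i%:R)%:F : K); split=> [i|k].
    rewrite /= !laurent_dery !(ode_sol_dy, ode_sol1_dy) /laurent_const.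
    by rewrite -!tofracM -!tofracD ode_sol2_dy tofrac0.
  rewrite /ineqs /wronskian_dpoly; case: (enum_val k) => i j /=.
  have nzF (f : R) : f 0%N != 0 -> f%:F != 0 :> K.
    move=> nzf; have : f != 0 by apply: contraNneq nzf => ->.
    by rewrite -tofrac_eq0.
  have [_|neij] := eqVneq (i : nat) (j : nat); first by apply: nzF; apply: oner_neq0.
  rewrite /= !laurent_dery !ode_sol_dy (rmorphN1 laurent_const) mulN1r.
  rewrite -!tofracM -tofracB; apply: nzF.
  have mul0E (f g : R) : (f * g) 0%N = f 0%N * g 0%N.
    by rewrite /GRing.mul /= /ps_mul big_ord1.
  (* The constant terms are 1, j and 1, i. *)
  have -> : (ode_sol i%:R * ode_sol1 j%:R - ode_sol j%:R * ode_sol1 i%:R : R) 0%N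
      = j%:R - i%:R.
    by rewrite ps_addE mul0E [(- _ : R) 0%N]/(- _ _) mul0E /= !mul1r.
  rewrite subr_eq0; apply: contra neij => /eqP eqji.
  wlog leij : i j eqji / (i <= j)%N => [hw|].
    by case/orP: (leq_total i j) => le; [apply: hw|rewrite eq_sym; apply: hw].
  have := (pcharf0P F).1 char0 (j - i)%N; rewrite natrB // eqji subrr eqxx.
  by move/esym; rewrite subn_eq0 eqn_leq leij.
exists e; split=> [i ltiN|i j ltiN ltjN neij].
  split; first exact: (He1 (Ordinal ltiN)).
  have := He2 (enum_rank (Ordinal ltiN, Ordinal ltiN)).
  by rewrite /ineqs enum_rankK /wronskian_dpoly /= eqxx.
have := He2 (enum_rank (Ordinal ltiN, Ordinal ltjN)).
by rewrite /ineqs enum_rankK /wronskian_dpoly /= (negbTE neij) /= mulN1r.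
Qed.

End LaurentField.

(** * Operators with infinitely many maximal overideals *)

Section FirstOrder.
Variable F : pdiffFieldType.
Local Notation D := (diffop F).
Implicit Types (a e : F) (P : D).

(** For a = e'/e this operator annihilates e. *)
Definition log_op a : D := opy - a%:A.

Lemma log_op_lead a : unit_lead false 1 (log_op a).
Proof.
exists 1, (- a%:A); split; first exact: oner_neq0.
  apply/(poly_lt1 _ (ord_ops_subring _ _)).
  by rewrite -scaleNr; apply: ord_ops_const.
by rewrite mulr_algl scale1r.
Qed.

Let w : 'I_2 -> nat := fun=> 1%N.

Lemma log_op_lead_form a : log_op a != 0 /\ lead_form w (log_op a) = 'X_iy.
Proof.
have [lfy degy] := @lead_form_dvar F w false.
have [|lf _] := @lead_form_addl F w (dvar F false) (- a%:A) (dvar_neq0 F w false).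
  have [_ dega] := @lead_form_const F w (- a).
  by rewrite -scaleNr dega degy orbT.
have lfE : lead_form w (log_op a) = 'X_iy by rewrite [LHS]lf lfy.
split=> //; rewrite -(lead_form_eq0 w) lfE.
by rewrite -msize_poly_eq0 msizeX.
Qed.

(** The leading form of a multiple of d_y - a is divisible by w, whereas that
    of a nonzero element of F[d_x] is a power of v up to a constant. *)
Lemma log_op_disjoint a : ~ meets_ord (principal (log_op a)) true.
Proof.
move=> [s [As nzs [C _ eqs]]]; have [_ lf] := log_op_lead_form a.
have w0 i : (0 < w i)%N by [].
have pt0 : coords (1 : F) 0 (var_index true) != 0 by apply: oner_neq0.
have lf0 : (lead_form w (log_op a)).@[coords 1 0] = 0 by rewrite lf mevalXU.
exact: (newton_no_ord w0 pt0 lf0 As nzs (esym eqs)).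
Qed.

Lemma log_op_non_holonomic a : non_holonomic (principal (log_op a)).
Proof.
have [nzL _] := log_op_lead_form a.
exact: (non_holonomic_disjoint (principal_ideal _) (principal_self _) nzL (@log_op_disjoint a)).
Qed.

(** An element outside the ideal reduces modulo d_y - a to a nonzero element
    of F[d_x], which a non-holonomic overideal cannot contain. *)
Lemma log_op_max P a : principal (log_op a) P ->
  max_non_holonomic_overideal (principal P) (principal (log_op a)).
Proof.
move=> LP; split.
  split; [exact: principal_ideal| |exact: log_op_non_holonomic].
  exact: (principal_sub (principal_ideal _)).
move=> I [idI _ nhI] subI; have IL : I (log_op a) by apply: subI; apply: principal_self.
have freeI := @disjoint_free _ I false
  (unit_lead_disjoint idI IL (log_op_lead a) nhI).
apply/seteqP; split=> // B IB; apply: contrapT => nB.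
have [Q [IQ nzQ ltQ]] := reduce_unit_lead idI IL (log_op_lead a) IB nB.
by case/eqP: nzQ; apply: freeI.
Qed.

(** Otherwise the difference of the generators would be a nonzero constant in
    the ideal. *)
Lemma log_op_inj a a' : principal (log_op a) = principal (log_op a') -> a = a'.
Proof.
move=> eqI; apply/eqP; rewrite -subr_eq0; apply/negPn/negP => nz.
apply: (@log_op_disjoint a); exists (a - a')%:A; split.
- exact: ord_ops_const.
- by rewrite const_neq0.
have -> : (a - a')%:A = log_op a' - log_op a.
  by rewrite /log_op scalerBl opprB [RHS]addrC addrA subrK.
apply: (idealB (principal_ideal _)); last exact: principal_self.
by rewrite eqI; apply: principal_self.
Qed.

(** Modulo d_y - e'/e, the operator d_y^k is congruent to the function
    e^(k)/e. *)
Lemma log_op_power e k : e != 0 ->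
  principal (log_op (dery e / e)) (opy ^+ k - (iter k dery e / e)%:A).
Proof.
move=> nze; set a := dery e / e.
have idL := principal_ideal (log_op a).
elim: k => [|k IHk].
  by rewrite expr0 /= divff // scale1r subrr; apply: ideal0.
set r := iter k dery e / e; have IHr : principal (log_op a) (opy ^+ k - r%:A) := IHk.
have der_r : dery r = iter k.+1 dery e / e - r * a.
  have : dery (r * e) = iter k.+1 dery e by rewrite /r divfK.
  rewrite deryM => eqd; apply: (mulIf nze); rewrite mulrBl divfK // -eqd.
  have -> : r * a * e = r * dery e by rewrite -mulrA divfK.
  by rewrite addrK.
have -> : opy ^+ k.+1 - (iter k.+1 dery e / e)%:A
    = opy * (opy ^+ k - r%:A) + r *: log_op a.
  rewrite exprS mulrBr opyC der_r /log_op scalerBr scalerA scalerBl.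
  rewrite opprD opprB !addrA [RHS](ACl (1*4*(2*5)*(3*6))%AC) /=.
  by rewrite addNr subrr !addr0.
by apply: idealD => //; [apply: idealM|apply: idealZ => //; apply: principal_self].
Qed.

(** If e is a nonzero solution, P is congruent modulo d_y - e'/e to P(e)/e =
    0. Nonzero Wronskians make the functions e'/e, and hence the ideals,
    pairwise distinct. *)
Lemma infinite_log_ops (char0 : [pchar F] =i pred0) (Fclosed : differentially_closed F)
  (p1 p3 p5 : F) :
  infinite_set [set I | max_non_holonomic_overideal
     (principal (opy ^+ 3 + p1 *: opy ^+ 2 + p3 *: opy + p5%:A)) I].
Proof.
set P := opy ^+ 3 + _ + _ + _.
move=> /finite_seqP [s eqs].
(* One more ideal than a purported finite enumeration has entries. *)
have [e [ode wr]] := ode_solutions char0 p1 p3 p5 (size s).+1 Fclosed.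
pose I i := principal (log_op (dery (e i) / e i)).
have I_in i : (i < (size s).+1)%N -> I i \in s.
  move=> lti; have [odei nze] := ode i lti.
  have : max_non_holonomic_overideal (principal P) (I i).
    apply: log_op_max.
    have idL := principal_ideal (log_op (dery (e i) / e i)).
    have L k := log_op_power k nze.
    have -> : P = (opy ^+ 3 - (iter 3 dery (e i) / e i)%:A)
        + p1 *: (opy ^+ 2 - (iter 2 dery (e i) / e i)%:A)
        + p3 *: (opy ^+ 1 - (iter 1 dery (e i) / e i)%:A).
      have p5E : p5 = - (iter 3 dery (e i) / e i + p1 * (iter 2 dery (e i) / e i)
          + p3 * (iter 1 dery (e i) / e i)).
        apply: (mulIf nze); apply/subr0_eq; rewrite -[RHS]odei /=.
        by field.
      rewrite /P p5E scaleNr !scalerDl !scalerBr !scalerA !opprD !addrA expr1.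
      by rewrite [LHS](ACl (1*4*2*5*3*6)%AC).
    by apply: idealD => //; [apply: idealD => //|]; try apply: idealZ => //; apply: L.
  by rewrite -[X in X -> _]/([set J | max_non_holonomic_overideal (principal P) J] (I i)) eqs.
have uniqI : uniq [seq I i | i <- iota 0 (size s).+1].
  rewrite map_inj_in_uniq ?iota_uniq // => i j.
  rewrite !mem_iota !add0n => /= lti ltj /log_op_inj eqij.
  apply/eqP/negPn/negP => neij; have := wr i j lti ltj neij.
  have [[_ nzi] [_ nzj]] := (ode i lti, ode j ltj).
  move/eqP: eqij; rewrite eqr_div // => /eqP eqij.
  by rewrite [e j * _]mulrC eqij mulrC subrr eqxx.
have : (size [seq I i | i <- iota 0 (size s).+1] <= size s)%N.
  apply: uniq_leq_size => // J /mapP [i]; rewrite mem_iota add0n => /= lti ->.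
  exact: I_in.
by rewrite size_map size_iota ltnn.
Qed.

End FirstOrder.

Theorem proposition2 (F : pdiffFieldType) (char0 : [pchar F] =i pred0)
  (Fclosed : differentially_closed F) (P : diffop F) (orderP : has_order 3 P)
  (nonsep : ~ separable (symb P)) :
  (two_linear_divisors (symb P) ->
   forall p0 p1 p2 p3 p4 p5 : F,
   P = opy ^+ 2 * opx + p0 *: opx ^+ 2 + p1 *: opy ^+ 2 + p2 *: (opx * opy)
       + p3 *: opy + p4 *: opx + p5%:A ->
   p0 != 0 ->
   at_most_two (max_non_holonomic_overideal (principal P)) /\
   (forall I1 I2 : set (diffop F),
      max_non_holonomic_overideal (principal P) I1 ->
      max_non_holonomic_overideal (principal P) I2 ->
      I1 <> I2 -> principal P = I1 `&` I2))
  /\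
  (single_linear_divisor (symb P) ->
   forall p0 p1 p2 p3 p4 p5 : F,
   P = opy ^+ 3 + p0 *: opx ^+ 2 + p1 *: opy ^+ 2 + p2 *: (opx * opy)
       + p3 *: opy + p4 *: opx + p5%:A ->
   ([\/ p0 != 0, p2 != 0 | p4 != 0] ->
    at_most_two (max_non_holonomic_overideal (principal P)) /\
    (forall I1 I2 : set (diffop F),
       max_non_holonomic_overideal (principal P) I1 ->
       max_non_holonomic_overideal (principal P) I2 ->
       I1 <> I2 -> principal P = I1 `&` I2))
   /\
   (p0 = 0 -> p2 = 0 -> p4 = 0 ->
    principal P = principal (opy ^+ 3 + p1 *: opy ^+ 2 + p3 *: opy + p5%:A) /\
    infinite_set [set I | max_non_holonomic_overideal (principal P) I])).
Proof.
split=> [_ p0 p1 p2 p3 p4 p5 defP nzp0|_ p0 p1 p2 p3 p4 p5 defP].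
  exact: (case_double_simple defP nzp0).
split=> [nz|p00 p20 p40].
  have [p00|nzp0] := eqVneq p0 0; last exact: (case_triple_p0 defP nzp0).
  have [p20|nzp2] := eqVneq p2 0; last exact: (case_triple_p2 defP p00 nzp2).
  apply: (case_triple_p4 defP p00 p20).
  by case: nz; rewrite ?p00 ?p20 ?eqxx.
have -> : P = opy ^+ 3 + p1 *: opy ^+ 2 + p3 *: opy + p5%:A.
  by rewrite defP p00 p20 p40 !scale0r !addr0.
by split=> //; apply: infinite_log_ops.
Qed.
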